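(* Let $\mathcal{L}=\mathfrak{n}/\mathfrak{m}$ and $L$ be as in the context, and let $s=|S|$ be the number of symbols $\otimes$ in the diagram $\mathcal{D}_{\mathcal{L}}$, with $S=\{\xi_1,\ldots,\xi_s\}$, where $\xi_i$ is the place receiving $\otimes$ at step $i$. Then there exist $z_1,\ldots,z_s\in K[\mathcal{L}^*]^L$ such that: (1) for every $i$, $z_i=y_{\xi_i}Q_i+P_{>i}$, where $Q_i$ is some product of powers of $z_1,\ldots,z_{i-1}$ and $P_{>i}$ is a polynomial in the variables $y_\eta$ with $\eta\succ\xi_i$; (2) if $\mathcal{Z}$ denotes the multiplicative (denominator) subset generated by $z_1,\ldots,z_s$, then the localization $K[\mathcal{L}^*]_{\mathcal{Z}}$ is isomorphic as a Poisson algebra to the tensor product $K[z_1^{\pm1},\ldots,z_s^{\pm1}]\otimes\mathbb{A}_m$ for some $m\ge 0$.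
   Context: $K$ is a field of characteristic zero, $n\ge 2$. $\mathfrak{n}=\mathfrak{ut}(n,K)$ is the Lie algebra of strictly lower triangular $n\times n$ matrices, $N=\mathrm{UT}(n,K)$ the group of lower unitriangular matrices. $A=\{(i,j): n\ge i>j\ge 1\}$, and $y_{ij}$ ($(i,j)\in A$) denotes the matrix unit $E_{ij}$, so $[y_{ab},y_{cd}]=\delta_{bc}y_{ad}-\delta_{da}y_{cb}$; we also write $y_\xi$ for $y_{ij}$ with $\xi=(i,j)$. Let $M\subset A$ be a subset such that $\mathfrak{m}=\mathrm{span}_K\{y_\xi:\xi\in M\}$ is an ideal of $\mathfrak{n}$; $\mathcal{L}=\mathfrak{n}/\mathfrak{m}$ and $L=N/\exp(\mathfrak{m})$. $K[\mathcal{L}^*]$ is identified with the symmetric algebra $S(\mathcal{L})$, i.e. the polynomial algebra in $y_\xi$, $\xi\in A\setminus M$ (with $y_\xi=0$ for $\xi\in M$), with Poisson bracket determined by $\{x,y\}=[x,y]$ for $x,y\in\mathcal{L}$; $K[\mathcal{L}^*]^L$ is the algebra of invariants of the coadjoint action of $L$. $\mathbb{A}_m$ is the Poisson algebra $K[p_1,\ldots,p_m,q_1,\ldots,q_m]$ with $\{p_i,q_j\}=\delta_{ij}$, $\{p_i,p_j\}=\{q_i,q_j\}=0$; a tensor product of Poisson algebras means the tensor product of commutative algebras with the two factors Poisson-commuting. Order on $A$: $(i,j)\succ(i',j')$ iff $j<j'$, or $j=j'$ and $i>i'$ (so $(n,1)\succ(n-1,1)\succ\cdots\succ(2,1)\succ(n,2)\succ\cdots\succ(n,n-1)$).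 Diagram $\mathcal{D}_{\mathcal{L}}$: places of $A$ are filled with symbols $\bullet,\otimes,+,-$. Step 0: fill every place of $M$ with $\bullet$. Step $i\ge1$ (performed while unfilled places of $A$ remain): put $\otimes$ on the $\succ$-greatest unfilled place $(k,t)$; then for each $a$ with $t<a<k$ such that both $(k,a)$ and $(a,t)$ are still unfilled, put $-$ on $(k,a)$ and $+$ on $(a,t)$ (if one of these two places is already filled, leave the other unchanged). The process ends when all places are filled. $S$, $C^+$, $C^-$ denote the sets of places filled with $\otimes$, $+$, $-$ respectively, so $A=M\sqcup C^+\sqcup C^-\sqcup S$. *)

(* Defs.v *)
From HB Require Import structures.
From mathcomp Require Import all_boot all_order all_algebra.
From mathcomp Require Import mpoly.
Set Implicit Arguments.
Unset Strict Implicit.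
Unset Printing Implicit Defensive.
Import Order.TTheory GRing.Theory.
Local Open Scope ring_scope.

(* Conventions: indices are 0-based.  The paper's place (i,j), n>=i>j>=1,
   is the pair (i-1, j-1) : 'I_n * 'I_n. *)
Notation place n := ('I_n * 'I_n)%type.

Notation "x %:F" := (@FracField.tofrac _ x) : ring_scope.

Section Lie.
Variables (K : fieldType) (n : nat) (M : {set place n}).

Definition inA (p : place n) : bool := (p.2 < p.1)%N.

(* span{y_xi : xi in M} is an ideal of ut(n,K), with
   [y_ab, y_cd] = delta_bc y_ad - delta_da y_cb. *)
Definition is_ideal : Prop :=
  (forall p, p \in M -> inA p) /\
  (forall a b c d : 'I_n, (a, b) \in M -> inA (c, d) ->
     (b == c -> (a, d) \in M) /\ (d == a -> (c, b) \in M)).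

Definition inL (p : place n) : bool := inA p && (p \notin M).

Definition nvar := #|{: place n}|.
Definition Pol := {mpoly K[nvar]}.
Definition vidx (p : place n) : 'I_nvar := enum_rank p.
Definition y (p : place n) : Pol := 'X_(vidx p).
Definition yL (p : place n) : Pol := if inL p then y p else 0.

Definition vars_in (P : pred (place n)) (f : Pol) : Prop :=
  forall m, m \in msupp f -> forall p, ~~ P p -> m (vidx p) = 0%N.

Definition inSL (f : Pol) : Prop := vars_in inL f.

Definition lbr (p q : place n) : Pol :=
  (p.2 == q.1)%:R * yL (p.1, q.2) - (q.2 == p.1)%:R * yL (q.1, p.2).

Definition pbr (f g : Pol) : Pol :=
  \sum_(p | inL p) \sum_(q | inL q)
     (f^`M(vidx p) * g^`M(vidx q) * lbr p q).

Definition lowunitri (g : 'M[K]_n) : Prop :=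
  forall i j : 'I_n, (g i i = 1) /\ ((i < j)%N -> g i j = 0).

(* coadjoint action of g on K[L^*] = S(L):  (g.f)(lambda) = f(lambda o Ad_g),
   i.e. the algebra morphism sending y_xi to sum_eta (g E_xi g^-1)_eta y_eta,
   where y_eta = 0 for eta in M.  Since exp(m) acts trivially, L-invariants
   are exactly the N-invariants for this action. *)
Definition coad_img (g : 'M[K]_n) (k : 'I_nvar) : Pol :=
  let p := enum_val k in
  if inL p then
    \sum_(q | inL q)
       ((g *m delta_mx p.1 p.2 *m invmx g) q.1 q.2) *: y q
  else 0.

Definition coad (g : 'M[K]_n) (f : Pol) : Pol :=
  mmap (@mpolyC _ K) (coad_img g) f.

Definition Linvariant (f : Pol) : Prop :=
  inSL f /\ forall g, lowunitri g -> coad g f = f.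

Inductive sym := Bul | Otim | Plus | Minus.

Definition gtA (p q : place n) : bool :=
  (p.2 < q.2)%N || ((p.2 == q.2) && (q.1 < p.1)%N).

Definition labels := {ffun place n -> option sym}.
Definition unfilled (lab : labels) (p : place n) : bool :=
  inA p && (if lab p is None then true else false).

Definition diag_init : labels * seq (place n) :=
  ([ffun p => if p \in M then Some Bul else None], [::]).

Definition diag_step (st : labels * seq (place n)) : labels * seq (place n) :=
  let: (lab, Sq) := st in
  match [pick p | unfilled lab p &&
                  [forall q, unfilled lab q ==> (q == p) || gtA p q]] with
  | None => st
  | Some (k, t) =>
    ([ffun q =>
       if q == (k, t) then Some Otim
       else if (q.1 == k) && (t < q.2 < k)%N
               && unfilled lab (k, q.2) && unfilled lab (q.2, t)
            then Some Minus
       else if (q.2 == t) && (t < q.1 < k)%N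
               && unfilled lab (k, q.1) && unfilled lab (q.1, t)
            then Some Plus
       else lab q], rcons Sq (k, t))
  end.

(* the process ends after at most |A| <= n*n steps *)
Definition diagram : labels * seq (place n) :=
  iter (n * n) diag_step diag_init.

Definition Sseq : seq (place n) := diagram.2.

(* Fraction field of the polynomial ring, containing K[L^*]_Z *)
Definition Frac := {fraction Pol}.

Definition fderiv (k : 'I_nvar) (x : Frac) : Frac :=
  let r := repr x in
  ((\n_r)^`M(k) * \d_r - \n_r * (\d_r)^`M(k))%:F / (\d_r ^+ 2)%:F.

(* the (unique) extension of the Poisson bracket to Frac *)
Definition fbr (x x' : Frac) : Frac :=
  \sum_(p | inL p) \sum_(q | inL q)
     (fderiv (vidx p) x * fderiv (vidx q) x' * (lbr p q)%:F).

End Lie.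

(* The model K[Z_1..Z_s] (x) A_m, variables Z_i, P_j, Q_j *)
Section Model.
Variables (K : fieldType) (s m : nat).
Definition Mod := {mpoly K[s + (m + m)]}.
Definition Zi (i : 'I_s) : 'I_(s + (m + m)) := lshift (m + m) i.
Definition Pj (j : 'I_m) : 'I_(s + (m + m)) := rshift s (lshift m j).
Definition Qj (j : 'I_m) : 'I_(s + (m + m)) := rshift s (rshift m j).
Definition modbr (F G : Mod) : Mod :=
  \sum_(j < m) (F^`M(Pj j) * G^`M(Qj j) - F^`M(Qj j) * G^`M(Pj j)).
End Model.

(* Main.v *)
Require Import Defs.
From HB Require Import structures.
From mathcomp Require Import all_boot all_order all_algebra.
From mathcomp Require Import mpoly.
From mathcomp Require Import ring zify.
Set Implicit Arguments.
Unset Strict Implicit.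
Unset Printing Implicit Defensive.
Import GRing.Theory.
Local Open Scope ring_scope.

(** The diagram is processed one symbol [otimes] at a time.  Write [a ~> b] if
the place (a,b) is still unfilled or lies in M.  This relation and its
complement among the pairs a > b >= t (t the current column) are both
transitive, so the unfilled places are the non-inversions of a permutation.
At each step K[L^*], localized at the central elements found so far, is
generated by those elements, the canonical pairs found so far, and a family
Y_ab indexed by the unfilled places, which commutes with them and obeys
{Y_ab, Y_cd} = delta_bc Y_ad - delta_da Y_cb.
If (k,t) is the greatest unfilled place, then Y_kt is central, and the places
(k,a), (a,t) receiving - and + give the canonical pairs Y_ka, Y_at / Y_kt.
A quadratic correction of the remaining Y_ij makes them commute with these
pairs; the two transitivity properties are what is needed for the corrected
family to satisfy the same commutation rules.
A Casimir is L-invariant because its translates along the path 1 + X(g - 1)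
have zero derivative.  The model is embedded because the brackets with p_j, q_j
and the derivatives in y_{xi_i} lower the degree of a relation. *)

(** * The unfilled places *)

Section Unfilled.
Variable n : nat.
Implicit Types (M U : rel 'I_n) (a b c d i j k t : 'I_n).

(** The correction away from column k is a Schur complement, Y_ij - Y_it Y_kj / Y_kt. In the bracket
    of the corrected Y_ij and Y_jd the extra terms add up to -Y_it Y_kd / Y_kt times [(k,j)] +
    [(j,t)] - [(k,j)][(j,t)], where [ ] is 1 if the place is unfilled and 0 otherwise. The rule asks
    for the coefficient 1, so one of the two places must be unfilled whenever Y_it is nonzero: this
    is what transitivity of the complement provides. Transitivity of the relation itself keeps the
    right-hand sides of the rule on places that are unfilled or in M. Column k needs a different
    formula: the Schur correction of Y_ek would be zero there since Y_kk = 0, yet {Y_ek, Y_kj} =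
    Y_ej must be cancelled when (k,j) is paired with (j,t). Adding the sum of Y_ct Y_ec / Y_kt over
    c != k does so, because {Y_jt, Y_kj} = -Y_kt. The corrections introduce denominators, which are
    monomials in the earlier central elements. Hence z_i is not Y_kt itself but its product with
    such a monomial m; this m is the factor Q_i. *)

Definition arrow U M a b := U a b || M a b.

(* [unf_cotrans] is transitivity of the complement of [arrow], in the columns
   from [t] on; [unf_below] says that rows reaching into M are still intact. *)
Record unfilled_inv M (t : nat) U : Prop := UnfilledInv {
  unf_lt : forall a b, U a b -> (b < a)%N;
  unf_notM : forall a b, U a b -> ~~ M a b;
  unf_col : forall a b, U a b -> (t <= b)%N;
  unf_trans : forall a b c,
    arrow U M a b -> arrow U M b c -> arrow U M a c;
  unf_cotrans : forall a b c, (c < b < a)%N -> (t <= c)%N ->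
    arrow U M a c -> arrow U M a b || arrow U M b c;
  unf_below : forall c j d, M c j -> (t <= j)%N -> (t <= d < c)%N ->
    arrow U M c d
}.

Definition ideal_places M :=
  (forall a b, M a b -> (b < a)%N) /\
  (forall a b a' b', M a b -> (a <= a')%N -> (b' <= b)%N -> M a' b').

Definition top_unfilled U k t :=
  U k t /\ forall a b, U a b -> (t < b)%N \/ b = t /\ (a <= k)%N.

Definition unfilled_next U k t : rel 'I_n := fun a b =>
  [&& U a b, (a, b) != (k, t), ~~ ((a == k) && U b t)
    & ~~ ((b == t) && U k a)].

(** Lets the current column advance once all unfilled places lie further right: raising [t] only
    narrows the range of the last two fields. *)
Lemma unfilled_inv_weaken M (t t' : nat) U :
  unfilled_inv M t U -> (t <= t')%N -> (forall a b, U a b -> (t' <= b)%N) ->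
  unfilled_inv M t' U.
Proof.
case=> H1 H2 H3 H4 H5 H6 tt' H; split => //.
- by move=> a b c h1 h2; apply: H5 => //; exact: leq_trans h2.
- move=> c j d h1 h2 /andP[h3 h4]; apply: (H6 _ j) => //.
    exact: leq_trans h2.
  by rewrite h4 andbT (leq_trans tt').
Qed.

(** * Removing the greatest unfilled place together with the paired places *)

Section NextUnfilled.
Variables (M U : rel 'I_n) (k t : 'I_n).
Hypotheses (idM : ideal_places M) (invU : unfilled_inv M t U).
Hypothesis top : top_unfilled U k t.
Let Ukt : U k t. Proof. by case: top. Qed.
Let ltM := idM.1.
Let monoM := idM.2.
Local Notation U' := (unfilled_next U k t).
Local Notation "a ~> b" := (arrow U M a b) (at level 70).

Lemma arrow_lt a b : a ~> b -> (b < a)%N.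
Proof. by case/orP; [exact: (unf_lt invU) | exact: ltM]. Qed.

Lemma top_lt : (t < k)%N. Proof. exact: (unf_lt invU). Qed.

Lemma notM_top a : M a t -> (k < a)%N.
Proof.
move=> h; rewrite ltnNge; apply/negP => h'.
by have := unf_notM invU Ukt; rewrite (monoM h).
Qed.

Lemma notM_row_top a : M k a -> (a < t)%N.
Proof.
move=> h; rewrite ltnNge; apply/negP => h'.
by have := unf_notM invU Ukt; rewrite (monoM h).
Qed.

Lemma U_row_top a : k ~> a -> (t <= a)%N -> U k a.
Proof. by case/orP => // /notM_row_top; lia. Qed.

Lemma U_col_top a : a ~> t -> (a <= k)%N -> U a t.
Proof. by case/orP => // /notM_top; lia. Qed.

Lemma U_top_le a : U a t -> (a <= k)%N.
Proof. by move=> /(proj2 top) []; [lia | case]. Qed.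

Lemma M_top a : a ~> t -> (k < a)%N -> M a t.
Proof. by case/orP=> // /U_top_le; lia. Qed.

(** Cotransitivity applied to k ~> t through b. So a strictly intermediate index either yields a
    canonical pair, or has exactly one of its two places unfilled, and that one stays. *)
Lemma row_or_col b : (t < b < k)%N -> U k b || U b t.
Proof.
move=> /andP[tb bk].
have /orP[h|h] : (k ~> b) || (b ~> t).
  apply: (unf_cotrans invU) => //; first by rewrite tb bk.
  by rewrite /arrow Ukt.
- by rewrite U_row_top // ltnW.
- by rewrite (U_col_top h) ?orbT // ltnW.
Qed.

Lemma unfilled_nextW a b : U' a b -> U a b.
Proof. by case/and4P. Qed.

Lemma arrow_next a b : arrow U' M a b -> a ~> b.
Proof. by rewrite /arrow => /orP[/unfilled_nextW ->|->] //; rewrite orbT. Qed.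

Lemma arrow_removed a b : a ~> b -> ~~ arrow U' M a b ->
  [\/ a = k /\ b = t, a = k /\ U b t | b = t /\ U k a].
Proof.
rewrite /arrow; case: (M a b); rewrite ?orbT // !orbF /unfilled_next => ->.
rewrite andTb 2!negb_and !negbK => /or3P[/eqP[-> ->]|/andP[/eqP-> ?]|/andP[/eqP-> ?]].
- by constructor 1.
- by constructor 2.
- by constructor 3.
Qed.

Lemma next_row a : arrow U' M k a -> ~~ U a t.
Proof.
case/orP=> [/and4P[_ _]|/notM_row_top h]; first by rewrite eqxx.
by apply/negP => /(unf_lt invU); lia.
Qed.

Lemma next_row_neq a : arrow U' M k a -> a != t.
Proof.
case/orP=> [/and4P[_]|/notM_row_top h]; first by rewrite xpair_eqE eqxx.
by apply/eqP => ?; subst; lia.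
Qed.

Lemma next_col a : arrow U' M a t -> ~~ U k a.
Proof.
case/orP=> [/and4P[_ _ _]|/notM_top h]; first by rewrite eqxx.
by apply/negP => /(unf_lt invU); lia.
Qed.

Lemma next_col_neq a : arrow U' M a t -> a != k.
Proof.
case/orP=> [/and4P[_]|/notM_top h]; first by rewrite xpair_eqE eqxx andbT.
by apply/eqP => ?; subst; lia.
Qed.

(** If (a,c) were removed, transitivity of the old relation would make the partner of (a,b) or of
    (b,c) unfilled, so that this place would have been removed too. *)
Lemma next_trans a b c :
  arrow U' M a b -> arrow U' M b c -> arrow U' M a c.
Proof.
move=> ab bc; have ab' := arrow_next ab; have bc' := arrow_next bc.
have ac := unf_trans invU ab' bc'.
apply/negPn/negP => /(arrow_removed ac) [[? ?]|[? Uct]|[? Uka]]; subst.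
- have := next_row ab; rewrite (U_col_top bc') // ltnW //.
  exact: arrow_lt.
- have bt : b ~> t by apply: (unf_trans invU bc'); rewrite /arrow Uct.
  have := next_row ab; rewrite (U_col_top bt) // ltnW //.
  exact: arrow_lt.
- have kb : k ~> b by apply: (unf_trans invU _ ab'); rewrite /arrow Uka.
  have := next_col bc; rewrite (U_row_top kb) // ltnW //.
  exact: arrow_lt.
Qed.

Lemma next_cotrans a b c : (c < b < a)%N -> (t <= c)%N ->
  arrow U' M a c -> arrow U' M a b || arrow U' M b c.
Proof.
move=> /andP[cb ba] tc ac; have ac' := arrow_next ac.
apply/negPn/negP; rewrite negb_or => /andP[nab nbc].
(* If (a,b) was removed, then a = k and its partner is (b,t). Splitting b ~> t at c gives b ~> c,
   which survives, or c ~> t, which would have removed (k,c). *)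
have kill (h : a ~> b) : False.
  case: (arrow_removed h nab) => [[? ?]|[? Ubt]|[? Uka]]; subst; try lia.
  have ct : c != t := next_row_neq ac.
  have tc' : (t < c)%N by rewrite ltn_neqAle eq_sym ct tc.
  have : (b ~> c) || (c ~> t).
    by apply: (unf_cotrans invU); rewrite ?tc' ?cb // /arrow Ubt.
  have nct : ~~ (c ~> t).
    apply/negP => h'; have := next_row ac.
    by rewrite (U_col_top h') // ltnW // (ltn_trans cb).
  rewrite (negPf nct) orbF => bc.
  by case: (arrow_removed bc nbc) => [[bk ?]|[bk _]|[c_t _]];
    [move: ba; rewrite bk ltnn|move: ba; rewrite bk ltnn|rewrite c_t eqxx in ct].
have nab' : ~~ (a ~> b) by apply/negP.
have := unf_cotrans invU (_ : (c < b < a)%N) tc ac'.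
rewrite cb ba (negPf nab') /= => /(_ isT) bc.
(* A row below k that reaches column t is in M there, hence intact by [unf_below]. *)
have far : (k < a)%N -> a ~> t -> False.
  move=> ka at_; have Mat := M_top at_ ka.
  have ab : a ~> b.
    by apply: (unf_below invU Mat) => //; rewrite ba andbT; lia.
  by rewrite ab in nab'.
case: (arrow_removed bc nbc) => [[? ?]|[? Uct]|[? Ukb]]; subst.
- by apply: far.
- by apply: far => //; apply: (unf_trans invU ac'); rewrite /arrow Uct.
- have nka := next_col ac; have ak := next_col_neq ac.
  have [ka|ak'] := ltnP k a; first exact: far.
  (* Cotransitivity on k ~> b through a would make (k,a) unfilled, and then (a,t) would have been
     removed with it. *)
  have ak2 : (a < k)%N by rewrite ltn_neqAle ak.
  have : (k ~> a) || (a ~> b).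
    by apply: (unf_cotrans invU); rewrite ?ba ?ak2 ?(ltnW cb) // /arrow Ukb.
  rewrite (negPf nab') orbF => /U_row_top h.
  by rewrite h // in nka; lia.
Qed.

Lemma unfilled_inv_next : unfilled_inv M t U'.
Proof.
split.
- by move=> a b /unfilled_nextW /(unf_lt invU).
- by move=> a b /unfilled_nextW /(unf_notM invU).
- by move=> a b /unfilled_nextW /(unf_col invU).
- exact: next_trans.
- exact: next_cotrans.
move=> c j d Mcj tj tdc; have h := unf_below invU Mcj tj tdc.
have Mct : M c t by apply: (monoM Mcj).
have kc := notM_top Mct.
apply/negPn/negP => /(arrow_removed h) [[? ?]|[? _]|[_ Ukc]]; subst; try lia.
by have := unf_lt invU Ukc; lia.
Qed.

End NextUnfilled.
End Unfilled.

(** * One step of Poisson reduction *)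

(* Only a skew biderivation: the Jacobi identity is not imposed. *)
Record is_poisson (F : fieldType) (br : F -> F -> F) : Prop := IsPoisson {
  brC : forall x y, br x y = - br y x;
  brDl : forall x y w, br (x + y) w = br x w + br y w;
  brMl : forall x y w, br (x * y) w = x * br y w + br x w * y
}.

(** * Calculus with a skew biderivation on a field *)

Section Poisson.
Variables (F : fieldType) (br : F -> F -> F).
Hypothesis brP : is_poisson br.
Implicit Types x y z w : F.

Lemma brDr x y w : br w (x + y) = br w x + br w y.
Proof. by rewrite (brC brP) (brDl brP) opprD -!(brC brP). Qed.

Lemma br0l x : br 0 x = 0.
Proof. by apply: (addrI (br 0 x)); rewrite -(brDl brP) !addr0. Qed.

Lemma br0r x : br x 0 = 0.
Proof. by rewrite (brC brP) br0l oppr0. Qed.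

Lemma brNl x y : br (- x) y = - br x y.
Proof. by apply/eqP; rewrite -addr_eq0 -(brDl brP) addNr br0l. Qed.

Lemma brBl x y w : br (x - y) w = br x w - br y w.
Proof. by rewrite (brDl brP) brNl. Qed.

Lemma brNr x y : br x (- y) = - br x y.
Proof. by rewrite (brC brP) brNl -(brC brP). Qed.

Lemma brBr x y w : br w (x - y) = br w x - br w y.
Proof. by rewrite brDr brNr. Qed.

Lemma brMr x y w : br w (x * y) = x * br w y + br w x * y.
Proof. by rewrite (brC brP) (brMl brP) opprD -mulrN -mulNr -!(brC brP). Qed.

Lemma br1l x : br 1 x = 0.
Proof.
have := brMl brP 1 1 x; rewrite !mulr1 mul1r => /eqP.
by rewrite -subr_eq0 opprD addrA subrr sub0r oppr_eq0 => /eqP.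
Qed.

Lemma brVl x y : br x y = 0 -> br x^-1 y = 0.
Proof.
move=> h; have [->|x0] := eqVneq x 0; first by rewrite invr0 br0l.
have := br1l y; rewrite -(divff x0) (brMl brP) h mul0r addr0 => /eqP.
by rewrite mulf_eq0 (negPf x0) => /eqP.
Qed.

Lemma brMl0 x y w : br x w = 0 -> br y w = 0 -> br (x * y) w = 0.
Proof. by move=> hx hy; rewrite (brMl brP) hx hy mulr0 mul0r addr0. Qed.

Lemma br0C x y : br x y = 0 -> br y x = 0.
Proof. by rewrite (brC brP) => /eqP; rewrite oppr_eq0 => /eqP. Qed.

Lemma br_suml (I : Type) (r : seq I) (P : pred I) (f : I -> F) x :
  br (\sum_(i <- r | P i) f i) x = \sum_(i <- r | P i) br (f i) x.
Proof.
by elim/big_rec2: _ => [|i y1 y2 _ <-]; [rewrite br0l | rewrite (brDl brP)].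
Qed.

Lemma br_sumr (I : Type) (r : seq I) (P : pred I) (f : I -> F) x :
  br x (\sum_(i <- r | P i) f i) = \sum_(i <- r | P i) br x (f i).
Proof.
by elim/big_rec2: _ => [|i y1 y2 _ <-]; [rewrite br0r | rewrite brDr].
Qed.

Lemma brMVl z x w : br z w = 0 -> br (x / z) w = br x w / z.
Proof. by move=> h; rewrite (brMl brP) brVl // mulr0 add0r. Qed.

Lemma brMVr z x w : br z w = 0 -> br w (x / z) = br w x / z.
Proof. by move=> h; rewrite (brC brP) brMVl // -mulNr -(brC brP). Qed.

End Poisson.

Lemma sum_eqb (R : pzRingType) (I : finType) (P : pred I) (j : I) (f : I -> R) :
  \sum_(i | P i) (i == j)%:R * f i = (P j)%:R * f j.
Proof.
rewrite big_mkcond (bigD1 j) //= eqxx mul1r big1 ?addr0; first by case: (P j);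
  rewrite ?mul1r ?mul0r.
by move=> i /negPf ->; rewrite mul0r if_same.
Qed.

(** The relations of matrix units. Extending Y by zero gives a meaning to right-hand sides that
    leave the unfilled places. *)
Definition lie_family n (M U : rel 'I_n) (F : fieldType) (br : F -> F -> F)
    (Y : 'I_n -> 'I_n -> F) :=
  (forall a b, ~~ U a b -> Y a b = 0) /\
  (forall a b c d, U a b -> U c d ->
     br (Y a b) (Y c d) = (b == c)%:R * Y a d - (d == a)%:R * Y c b).

(* Value at (a,b) of the corrected family: the middle case is the entry (a,t) of
   the square of the matrix Y divided by Y_kt, the last one a 2x2 minor. *)
Definition lie_next n (U : rel 'I_n) (F : fieldType) (Y : 'I_n -> 'I_n -> F)
    (k t a b : 'I_n) : F :=
  if ~~ unfilled_next U k t a b then 0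
  else if (b == t) || (a == k) then Y a b
  else if b == k then Y a k + (\sum_(c | c != k) Y c t * Y a c) / Y k t
  else Y a b - Y a t * Y k b / Y k t.

(** * The corrected family: its brackets, the new canonical pairs, and generation *)

Section PoissonStep.
Variables (n : nat) (M U : rel 'I_n) (k t : 'I_n).
Variables (F : fieldType) (br : F -> F -> F) (Y : 'I_n -> 'I_n -> F).
Hypotheses (idM : ideal_places M) (invU : unfilled_inv M t U).
Hypothesis top : top_unfilled U k t.
Hypotheses (brP : is_poisson br) (lieY : lie_family M U br Y).
Let z := Y k t.
Hypothesis z_neq0 : z != 0.
Let Ukt : U k t. Proof. by case: top. Qed.
Local Notation U' := (unfilled_next U k t).
Local Notation "a ~> b" := (arrow U M a b) (at level 70).
Local Notation Y' := (lie_next U Y k t).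

Let Y0 a b : ~~ U a b -> Y a b = 0. Proof. exact: lieY.1. Qed.

Let monoM (a b a' b' : 'I_n) : M a b -> (a <= a')%N -> (b' <= b)%N -> M a' b'.
Proof. exact: idM.2. Qed.

Let Y0M a b : M a b -> Y a b = 0.
Proof. by move=> h; apply: Y0; apply/negP => /(unf_notM invU); rewrite h. Qed.

(** If one of the two places lies in M, both sides vanish: Y is zero there, and the right-hand side
    falls into M again because M is an ideal. *)
Lemma lie_arrow a b c d : a ~> b -> c ~> d ->
  br (Y a b) (Y c d) = (b == c)%:R * Y a d - (d == a)%:R * Y c b.
Proof.
move=> ab cd; have ba := arrow_lt idM invU ab; have dc := arrow_lt idM invU cd.
have [Uab|nUab] := boolP (U a b); last first.
  have Mab : M a b by move: ab; rewrite /arrow (negPf nUab).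
  rewrite Y0 // (br0l brP).
  case: eqP => [bc|_]; last case: eqP => [da|_].
  - subst c; rewrite (Y0M (monoM Mab _ (ltnW dc))) // mulr0 sub0r.
    by case: eqP => [?|]; rewrite ?mul0r ?oppr0 //; subst; lia.
  - by subst d; rewrite (Y0M (monoM Mab (ltnW dc) _)) // !mul0r mulr0 subr0.
  - by rewrite !mul0r subr0.
have [Ucd|nUcd] := boolP (U c d); first exact: lieY.2.
have Mcd : M c d by move: cd; rewrite /arrow (negPf nUcd).
rewrite [Y c d]Y0 // (br0r brP).
case: eqP => [bc|_]; last case: eqP => [da|_].
- subst c; rewrite (Y0M (monoM Mcd (ltnW ba) _)) // mulr0 sub0r.
  by case: eqP => [?|]; rewrite ?mul0r ?oppr0 //; subst; lia.
- by subst d; rewrite (Y0M (monoM Mcd _ (ltnW ba))) // !mul0r mulr0 subr0.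
- by rewrite !mul0r subr0.
Qed.

Let topU a : U a t -> (a <= k)%N. Proof. exact: (U_top_le top). Qed.
Let ltU a b : U a b -> (b < a)%N. Proof. exact: (unf_lt invU). Qed.
Let colU a b : U a b -> (t <= b)%N. Proof. exact: (unf_col invU). Qed.
Let tk : (t < k)%N. Proof. exact: (top_lt invU top). Qed.

(** A contribution could only come from Y_at with a > k or from Y_kb with b < t, and the maximality
    of (k,t) leaves no such place unfilled. *)
Lemma br_top a b : a ~> b -> br (Y a b) z = 0.
Proof.
move=> ab; rewrite /z lie_arrow //; last by rewrite /arrow Ukt.
have ba := arrow_lt idM invU ab.
case: eqP => [bk|_]; last case: eqP => [da|_]; rewrite ?mul0r ?subr0 //.
- subst b; rewrite (_ : Y a t = 0) ?mulr0 ?sub0r.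
    by case: eqP => [ta|_]; rewrite ?mul0r ?oppr0 //; subst; lia.
  by apply: Y0; apply/negP => /topU; lia.
- by subst a; rewrite (_ : Y k b = 0) ?mulr0 ?subr0 // Y0 //; apply/negP=> /colU; lia.
Qed.


Let u a := Y a t.
Let r b := Y k b.

Let brz a b : a ~> b -> br z (Y a b) = 0.
Proof. by move=> ab; apply: (br0C brP); apply: br_top. Qed.

Let brzY a b : br z (Y a b) = 0.
Proof.
have [h|/Y0 ->] := boolP (U a b); last exact: (br0r brP).
by apply: brz; rewrite /arrow h.
Qed.

Let t_neq_k : t != k. Proof. by apply/eqP => h; move: tk; rewrite h ltnn. Qed.

Let gen_col i j a : i ~> j -> br (Y i j) (u a) = (U a t && (j == a))%:R * u i.
Proof.
move=> ij; rewrite /u; have [at_|/Y0 ->] := boolP (U a t);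
  last by rewrite (br0r brP) mul0r.
rewrite lie_arrow //= ?/arrow ?at_ //.
case: (t =P i) => [ti|_]; last by rewrite mul0r subr0.
subst i; rewrite (_ : Y a j = 0) ?mulr0 ?subr0 // Y0 //; apply/negP => /colU.
by have := arrow_lt idM invU ij; lia.
Qed.

Let gen_row i j b : i ~> j -> j != k ->
  br (Y i j) (r b) = - ((U k b && (b == i))%:R * r j).
Proof.
move=> ij jk; rewrite /r; have [kb|/Y0 ->] := boolP (U k b).
  by rewrite lie_arrow //= ?/arrow ?kb // (negPf jk) mul0r sub0r.
by rewrite (br0r brP) mul0r oppr0.
Qed.

Let col_col a b : br (u a) (u b) = 0.
Proof.
rewrite /u; have [h|/Y0 ->] := boolP (U a t); last by rewrite (br0l brP).
rewrite gen_col /arrow ?h //.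
case: andP => [[/ltU]|]; rewrite ?mul0r //.
by move=> h1 /eqP h2; subst; rewrite ltnn in h1.
Qed.

Let row_col b a : br (r b) (u a) = [&& U k b, U a t & b == a]%:R * z.
Proof.
rewrite /r; have [h|/Y0 ->] := boolP (U k b); last by rewrite (br0l brP) mul0r.
by rewrite gen_col /arrow ?h.
Qed.

Let col_row a b : br (u a) (r b) = - ([&& U k b, U a t & b == a]%:R * z).
Proof. by rewrite (brC brP) row_col. Qed.

Let row_row a b : br (r a) (r b) = 0.
Proof.
rewrite /r; have [h|/Y0 ->] := boolP (U k a); last by rewrite (br0l brP).
rewrite gen_row /arrow ?h //; last by apply/eqP => e; have := ltU h; rewrite e ltnn.
case: andP => [[/ltU]|]; rewrite ?mul0r ?oppr0 //.
by move=> h1 /eqP h2; subst; rewrite ltnn in h1.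
Qed.

(** Division by z passes through the bracket because z commutes with all six elements; the rest is
    the Leibniz rule. *)
Let br_expand a v s b v' s' : br z a = 0 -> br z v = 0 -> br z s = 0 ->
  br z b = 0 -> br z v' = 0 -> br z s' = 0 ->
  br (a - v * s / z) (b - v' * s' / z) = br a b
   - (v' * br a s' + br a v' * s') / z - (v * br s b + br v b * s) / z
   + (v * (v' * br s s' + br s v' * s') + (v' * br v s' + br v v' * s') * s) / z / z.
Proof.
move=> ha hv hs hb hv' hs'.
have zM x y : br z x = 0 -> br z y = 0 -> br z (x * y) = 0.
  by move=> hx hy; rewrite (brMr brP) hx hy mulr0 mul0r addr0.
have zz : br z (v' * s' / z) = 0.
  by rewrite (brMVr brP) ?zM ?mul0r //; exact: brzY.
rewrite (brBl brP) (brMVl brP); last by rewrite (brBr brP) hb zz subrr.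
rewrite !(brBr brP) !(brMVr brP) ?zM // !(brMr brP) !(brMl brP).
ring.
Qed.

Definition genA i j := Y i j - u i * r j / z.
(** The term c = k is left out since it equals z * Y e k, which after division by z is the leading
    term of [genE]. *)
Definition sumE e := \sum_(c | c != k) u c * Y e c.
Definition genE e := Y e k + sumE e / z.

(* The only place where [unf_cotrans] enters the bracket computations. *)
Let dich i j : i ~> j -> (t < j)%N -> u i = 0 \/ U k j || U j t.
Proof.
move=> ij tj; rewrite /u; have [it|/Y0] := boolP (U i t); last by left.
right; apply: (row_or_col idM invU top).
by rewrite tj (leq_trans (arrow_lt idM invU ij)) // topU.
Qed.

Let dich' i j : U i j -> j != t -> u i = 0 \/ U k j || U j t.
Proof.
move=> ij jt; apply: dich; first by rewrite /arrow ij.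
by rewrite ltn_neqAle eq_sym jt (colU ij).
Qed.

Lemma br_genA_genA i j c d : U i j -> U c d ->
  i != k -> j != k -> j != t -> c != k -> d != k -> d != t ->
  br (genA i j) (genA c d) = (j == c)%:R * genA i d - (d == i)%:R * genA c j.
Proof.
move=> Uij Ucd ik jk jt ck dk dt; rewrite /genA br_expand ?brzY //.
have ij : i ~> j by rewrite /arrow Uij.
have cd : c ~> d by rewrite /arrow Ucd.
rewrite lie_arrow // gen_row // gen_col // col_col row_row row_col col_row.
rewrite [br (r j) _](brC brP) [br (u i) (Y c d)](brC brP) gen_row // gen_col //.
have := dich' Uij jt; have := dich' Ucd dt.
have := ltU Uij; have := ltU Ucd.
case: (j =P c) => [jc|_]; first subst c; (case: (d =P i) => [di|_]; first subst d);
  rewrite ?andbF ?andbT => h1 h2 h3 h4.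
- by move: (ltn_trans h1 h2); rewrite ltnn.
(* With c = j, the coefficient of u_i r_d / z is an inclusion-exclusion sum in [U k j] and [U j t];
   it has the required value unless both fail, and then u_i = 0. *)
- move: z_neq0 h4 {h1 h2 h3}; generalize z (u i) (u j) (r d) (r j) (Y i d) (Y j j).
  move=> zz ui uj rd rj yid yjj z0 [->|]; first by field.
  by case: (U k j); case: (U j t) => //= _; field.
- move: z_neq0 h3 {h1 h2 h4}; generalize z (u i) (u c) (r i) (r j) (Y c j) (Y i i).
  move=> zz ui uc ri rj ycj yii z0 [->|]; first by field.
  by case: (U k i); case: (U i t) => //= _; field.
- move: z_neq0; generalize z (u i) (u c) (r d) (r j) (Y c j) (Y i d).
  by move=> zz ui uc rd rj ycj yid z0; field.
Qed.

Let br_genA i j w : i ~> j -> br z w = 0 ->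
  br (genA i j) w = br (Y i j) w - (u i * br (r j) w + br (u i) w * r j) / z.
Proof.
by move=> ij hw; rewrite /genA (brBl brP) (brMVl brP) // (brMl brP).
Qed.

(** {Y_ij, u_j} and the correction cancel exactly when (k,j) and (j,t) are both unfilled, that is
    when u_j enters a canonical pair; otherwise the old rule survives. *)
Lemma br_genA_col i j a : U i j -> j != t ->
  br (genA i j) (u a) = [&& U a t, ~~ U k j & j == a]%:R * u i.
Proof.
move=> ij jt; have ij' : i ~> j by rewrite /arrow ij.
rewrite br_genA ?brzY // gen_col // col_col row_col.
move: z_neq0; generalize z (u i) (r j) => zz ui rj z0.
by case: (U k j); case: (U a t); case: (j == a); rewrite /=; field.
Qed.

Lemma br_genA_row i j b : U i j -> j != k ->
  br (genA i j) (r b) = - ([&& U k b, ~~ U b t & b == i]%:R * r j).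
Proof.
move=> ij jk; have ij' : i ~> j by rewrite /arrow ij.
rewrite br_genA ?brzY // gen_row // row_row col_row.
have -> : [&& U k b, U i t & b == i] = [&& U k b, U b t & b == i].
  by case: eqP => [->|]; rewrite ?andbF.
move: z_neq0; generalize z (u i) (r j) => zz ui rj z0.
by case: (U k b); case: (U b t); case: (b == i); rewrite /=; field.
Qed.

(** Rows below k whose entry in column t has dropped into M: u_e vanishes, and the matrix-unit rule
    applies to Y_ec for every c from t up to e. *)
Definition far e := M e t /\ forall c : 'I_n, (t <= c < e)%N -> e ~> c.

(** Transitivity gives e ~> t. Since e > k, the place (e,t) cannot be unfilled, so it lies in M and
    [unf_below] applies. *)
Lemma far_next e : U e k -> far e.
Proof.
move=> ek.
have Met : M e t.
  apply: (M_top top (a := e)); last exact: ltU.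
  by apply: (unf_trans invU (b := k)); rewrite /arrow ?ek ?Ukt.
by split=> // c tc; apply: (unf_below invU Met).
Qed.

Let far_u e : far e -> u e = 0.
Proof. by case=> /Y0M. Qed.

Let far_gt e : far e -> (k < e)%N.
Proof. by case=> /(notM_top idM invU top). Qed.

Let far_arrow e c : far e -> U c t -> e ~> c.
Proof.
move=> fe ct; apply: fe.2; rewrite (ltnW (ltU ct)) /=.
by apply: leq_ltn_trans (topU ct) (far_gt fe).
Qed.

Let br_sumE e w : br (sumE e) w =
  \sum_(c | c != k) (u c * br (Y e c) w + br (u c) w * Y e c).
Proof. by rewrite /sumE (br_suml brP); apply: eq_bigr => c _; rewrite (brMl brP). Qed.

Let sumE_gen e i j : far e -> i ~> j -> br (sumE e) (Y i j) =
  (i != k)%:R * u i * Y e j - (j == e)%:R * sumE i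
  - (U j t && (j != k))%:R * u i * Y e j.
Proof.
move=> fe ij; rewrite br_sumE.
transitivity (\sum_(c | c != k) ((c == i)%:R * (u c * Y e j)
   - (j == e)%:R * (u c * Y i c) - (c == j)%:R * (U c t)%:R * u i * Y e c)).
  apply: eq_bigr => c ck.
  have [ct|nct] := boolP (U c t); last by rewrite /u (Y0 nct) (br0l brP) /=; ring.
  rewrite lie_arrow //; last exact: far_arrow.
  by rewrite [br (u c) _](brC brP) gen_col // ct [j == c]eq_sym; case: (c == i);
    case: (j == e); case: (c == j); rewrite /=; ring.
rewrite !sumrB sum_eqb -mulr_sumr mulrA; congr (_ - _).
under eq_bigr do rewrite -!mulrA.
by rewrite sum_eqb; case: (U j t); case: (j != k); rewrite /=; ring.
Qed.

Let sumE_col e a : far e -> br (sumE e) (u a) = 0.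
Proof.
move=> fe; rewrite br_sumE big1 // => c ck; rewrite col_col mul0r addr0.
have [ct|/Y0 nct] := boolP (U c t); last by rewrite /u nct mul0r.
rewrite gen_col; last exact: far_arrow.
by rewrite (far_u fe) !mulr0.
Qed.

Let sumE_row e b : far e ->
  br (sumE e) (r b) = - ((U k b && U b t)%:R * z * Y e b).
Proof.
move=> fe; rewrite br_sumE.
transitivity (\sum_(c | c != k) (c == b)%:R * - ((U k b && U c t)%:R * z * Y e c)).
  apply: eq_bigr => c ck.
  have [ct|/Y0 nct] := boolP (U c t); last first.
    by rewrite /u nct (br0l brP) !mul0r andbF !mul0r oppr0 mulr0 addr0.
  rewrite gen_row // ?far_arrow // (_ : U k b && (b == e) = false); last first.
    apply/negbTE/negP => /andP[/ltU h /eqP h']; subst.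
    by have := ltn_trans h (far_gt fe); rewrite ltnn.
  by rewrite col_row ct [b == c]eq_sym; case: (U k b); case: (c == b); rewrite /=; ring.
rewrite sum_eqb; have [->|bk] := eqVneq b k; last by rewrite mul1r.
rewrite (_ : U k k = false) /=; first by rewrite !mul0r oppr0.
by apply/negbTE/negP => /ltU; rewrite ltnn.
Qed.

Let sumE_z e : br z (sumE e) = 0.
Proof.
rewrite /sumE (br_sumr brP) big1 // => c _.
by rewrite (brMr brP) !brzY mulr0 mul0r addr0.
Qed.

Let br_genE e w : br z w = 0 -> br (genE e) w = br (Y e k) w + br (sumE e) w / z.
Proof. by move=> hw; rewrite /genE (brDl brP) (brMVl brP). Qed.

Let gen_rowk e j : e ~> k -> br (Y e k) (r j) = (U k j)%:R * Y e j.
Proof.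
move=> ek; rewrite /r; have [kj|/Y0 ->] := boolP (U k j).
  rewrite lie_arrow ?/arrow ?kj // eqxx (@Y0 k k) ?mulr0 ?subr0 //.
  by apply/negP => /ltU; rewrite ltnn.
by rewrite (br0r brP) mul0r.
Qed.

(** The unwanted term is u_i Y_ej / z with coefficient (1 - [(k,j)])(1 - [(j,t)]), [ ] indicating an
    unfilled place; by [dich'] either this coefficient or u_i is zero. *)
Lemma br_genE_genA e i j : U e k -> U i j -> i != k -> j != k -> j != t ->
  br (genE e) (genA i j) = - ((j == e)%:R * genE i).
Proof.
move=> Uek Uij ik jk jt; have fe := far_next Uek.
have ek : e ~> k by rewrite /arrow Uek.
have ij : i ~> j by rewrite /arrow Uij.
have zur : br z (u i * r j) = 0 by rewrite (brMr brP) !brzY mulr0 mul0r addr0.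
rewrite br_genE; last by rewrite /genA (brBr brP) (brMVr brP) ?brzY // zur mul0r subrr.
rewrite /genA !(brBr brP) !(brMVr brP) ?brzY ?sumE_z //.
rewrite !(brMr brP) lie_arrow // gen_col // sumE_gen // sumE_col // sumE_row //.
rewrite gen_rowk // (far_u fe) [k == i]eq_sym (negPf ik) (negPf jk) /= andbT.
have := dich' Uij jt; rewrite /genE.
move: z_neq0; generalize z (u i) (r j) (Y e j) (Y i k) (sumE i).
move=> zz ui rj yej yik si z0 [->|].
  by case: (j == e); rewrite /=; field.
by case: (U k j); case: (U j t); case: (j == e) => //= _; field.
Qed.

Lemma br_genE_genE e e' : U e k -> U e' k -> br (genE e) (genE e') = 0.
Proof.
move=> Uek Uek'; have fe := far_next Uek; have fe' := far_next Uek'.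
have ek : e ~> k by rewrite /arrow Uek.
have ek' : e' ~> k by rewrite /arrow Uek'.
have nk x : U x k -> (k == x) = false.
  by move=> /ltU h; apply/eqP => h'; rewrite -h' ltnn in h.
have SY x y : far x -> U y k -> far y -> br (sumE x) (Y y k) = 0.
  move=> fx Uyk fy; rewrite sumE_gen /arrow ?Uyk // (far_u fy) eqxx andbF.
  rewrite (_ : (k == x) = false) ?mulr0 ?mul0r ?subrr //.
  by apply/eqP => h; have := far_gt fx; rewrite -h ltnn.
rewrite br_genE; last by rewrite /genE (brDr brP) (brMVr brP) ?brzY // sumE_z
  mul0r addr0.
rewrite /genE !(brDr brP) !(brMVr brP) ?brzY ?sumE_z //.
rewrite lie_arrow // !nk // !mul0r subrr (SY e e') //.
rewrite [br (Y e k) _](brC brP) (SY e' e) // oppr0 mul0r !add0r.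
rewrite [X in X / z](_ : _ = 0) ?mul0r // (_ : br _ _ = 0) ?mul0r //.
(* Only the bracket of the two sums is left. After expanding one of them, every term not already
   zero carries a factor [u e] or [u e'], and both vanish since the rows are far. *)
rewrite (brC brP) br_sumE big1 ?oppr0 // => c ck.
rewrite [br (u c) _](brC brP) sumE_col // oppr0 mul0r addr0.
have [ct|/Y0 nct] := boolP (U c t); last by rewrite /u nct mul0r.
rewrite [br (Y e' c) _](brC brP) sumE_gen //; last exact: far_arrow.
rewrite (far_u fe') !mulr0 !mul0r sub0r subr0.
case: (c =P e) => [ce|_]; last by rewrite mul0r !oppr0 mulr0.
by rewrite ce (far_u fe) mul0r.
Qed.

Lemma br_genE_col e a : U e k -> a != k -> br (genE e) (u a) = 0.
Proof.
move=> Uek ak; have fe := far_next Uek.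
rewrite br_genE ?brzY // sumE_col // mul0r addr0 gen_col ?/arrow ?Uek //.
by rewrite (far_u fe) mulr0.
Qed.

Lemma br_genE_row e b : U e k ->
  br (genE e) (r b) = (U k b && ~~ U b t)%:R * Y e b.
Proof.
move=> Uek; have fe := far_next Uek.
rewrite br_genE ?brzY // sumE_row // gen_rowk ?/arrow ?Uek //.
move: z_neq0; generalize z (Y e b) => zz yeb z0.
by case: (U k b); case: (U b t); rewrite /=; field.
Qed.

Let gen a b := if (b == t) || (a == k) then Y a b
               else if b == k then genE a else genA a b.

Let Y'E a b : U' a b -> Y' a b = gen a b.
Proof. by move=> h; rewrite /lie_next h. Qed.

(** The right-hand side of the rule may land in M, where [Y'] is zero by definition; the formulas of
    [gen] vanish there as well. *)
Let Y'E' a b : arrow U' M a b -> (t <= b)%N -> Y' a b = gen a b.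
Proof.
have [/Y'E //|n'] := boolP (U' a b); rewrite /arrow (negPf n') /= => Mab tb.
rewrite /lie_next n' /gen; case: ifP => _; first by rewrite Y0M.
have Mat : M a t by apply: (monoM Mab).
case: eqP => [bk|_]; last by rewrite /genA /u !Y0M // !mul0r subrr.
subst b; rewrite /genE /sumE Y0M // big1 ?mul0r ?addr0 // => c ck.
have [ct|/Y0 nct] := boolP (U c t); last by rewrite /u nct mul0r.
by rewrite (Y0M (monoM Mab _ (topU ct))) ?mulr0.
Qed.

Let row_col' k' b : arrow U' M k' b -> k' = k -> U b t = false.
Proof. by move=> h e; subst; apply/negbTE; apply: (next_row idM invU top h). Qed.

Let col_row' a t' : arrow U' M a t' -> t' = t -> U k a = false.
Proof. by move=> h e; subst; apply/negbTE; apply: (next_col idM invU top h). Qed.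

Let col_neq' a t' : arrow U' M a t' -> t' = t -> a != k.
Proof. by move=> h e; subst; apply: (next_col_neq idM invU top h). Qed.

Let Ulast x : U x x = false.
Proof. by apply/negbTE/negP => /ltU; rewrite ltnn. Qed.

Let genC a b : b = t -> gen a b = u a.
Proof. by move=> ->; rewrite /gen eqxx. Qed.
Let genR a b : a = k -> gen a b = r b.
Proof. by move=> ->; rewrite /gen eqxx orbT. Qed.
Let genE' a b : b = k -> a != k -> gen a b = genE a.
Proof. by move=> -> ak; rewrite /gen eqxx [k == t]eq_sym (negPf t_neq_k) (negPf
  ak). Qed.
Let genA' a b : b != t -> a != k -> b != k -> gen a b = genA a b.
Proof. by move=> bt ak bk; rewrite /gen (negPf bt) (negPf ak) (negPf bk). Qed.

Let rule a b c d := br (gen a b) (gen c d) =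
  (b == c)%:R * gen a d - (d == a)%:R * gen c b.

Let ruleC a b c d : rule a b c d -> rule c d a b.
Proof. by rewrite /rule => h; rewrite (brC brP) h opprB. Qed.

Let rule_col a b c d : U' a b -> U' c d -> b = t -> rule a b c d.
Proof.
move=> h1 h2 bt; rewrite /rule.
have U1 := unfilled_nextW h1; have U2 := unfilled_nextW h2.
have a1 : arrow U' M a b by rewrite /arrow h1.
have ct : (b == c) = false.
  by apply/eqP => h; have := leq_ltn_trans (colU U2) (ltU U2); rewrite -h bt ltnn.
rewrite ct mul0r sub0r (genC _ bt).
have kaF := col_row' a1 bt; have ak := col_neq' a1 bt.
have aF x : x = k -> (x == a) = false by move=> ->; rewrite eq_sym (negPf ak).
have [dt|dt] := eqVneq d t.
  rewrite (genC _ dt) col_col (_ : (d == a) = false) ?mul0r ?oppr0 //.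
  by apply/eqP => h; move: U1; rewrite bt -h dt Ulast.
have [ck|ck] := eqVneq c k.
  rewrite (genR _ ck) col_row (_ : (d == a) = false) ?andbF ?mul0r //.
  by apply/eqP => h; move: U2; rewrite ck h kaF.
have [dk|dk] := eqVneq d k.
  rewrite (genE' dk ck) (brC brP) br_genE_col //; last by rewrite -dk.
  by rewrite aF // mul0r.
rewrite (genA' dt ck dk) (genC _ bt) (brC brP) br_genA_col // -{1}bt U1.
by case: (d =P a) => [->|]; rewrite ?andbF // kaF.
Qed.

Let rule_row a b c d : U' a b -> U' c d -> a = k -> b != t -> d != t ->
  rule a b c d.
Proof.
move=> h1 h2 ak bt dt; rewrite /rule.
have U1 := unfilled_nextW h1; have U2 := unfilled_nextW h2.
have a1 : arrow U' M a b by rewrite /arrow h1.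
have btF := row_col' a1 ak.
have bk : b != k by apply/eqP => h; move: U1; rewrite h ak Ulast.
have [ck|ck] := eqVneq c k.
  have dk : d != k by apply/eqP => h; move: U2; rewrite h ck Ulast.
  by rewrite !(genR _ ak) !(genR _ ck) row_row ck ak (negPf bk) (negPf dk) !mul0r subrr.
rewrite !(genR _ ak) (brC brP).
have kb : U k b by rewrite -ak.
have [dk|dk] := eqVneq d k.
  have Uck : U c k by rewrite -dk.
  rewrite (genE' dk ck) br_genE_row // kb btF dk ak eqxx !mul1r.
  rewrite (genA' bt ck bk) /genA (far_u (far_next Uck)) !mul0r subr0.
  rewrite (_ : (b == c) = false) ?mul0r ?sub0r //.
  by apply/eqP => h; have := ltn_trans (ltU kb) (far_gt (far_next Uck)); rewrite h ltnn.
rewrite (genA' dt ck dk) br_genA_row // kb btF ak (negPf dk) mul0r subr0 opprK.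
by case: (b == c).
Qed.

Lemma lie_next_br a b c d : U' a b -> U' c d -> rule a b c d.
Proof.
move=> h1 h2.
have U1 := unfilled_nextW h1; have U2 := unfilled_nextW h2.
have [b_t|b_t] := eqVneq b t; first exact: rule_col.
have [d_t|d_t] := eqVneq d t; first by apply: ruleC; apply: rule_col.
have [a_k|a_k] := eqVneq a k; first exact: rule_row.
have [c_k|c_k] := eqVneq c k; first by apply: ruleC; apply: rule_row.
rewrite /rule.
have EA a' b' c' d' : U a' b' -> U c' d' -> a' != k -> c' != k -> d' != t ->
    b' = k -> d' != k -> rule a' b' c' d'.
  move=> u1 u2 ak ck dt bk dk; rewrite /rule (genE' bk ak) (genA' dt ck dk).
  have Uak : U a' k by rewrite -bk.
  by rewrite br_genE_genA // bk [k == c']eq_sym (negPf ck) mul0r sub0r (genE' _ ck).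
have [b_k|b_k] := eqVneq b k; have [d_k|d_k] := eqVneq d k.
- have Uak : U a k by rewrite -b_k.
  have Uck : U c k by rewrite -d_k.
  rewrite (genE' b_k a_k) (genE' d_k c_k) br_genE_genE // b_k d_k.
  by rewrite ![k == _]eq_sym (negPf a_k) (negPf c_k) !mul0r subrr.
- exact: EA.
- by apply: ruleC; apply: EA.
- rewrite !genA' // br_genA_genA //.
Qed.

Lemma lie_family_next : lie_family M U' br Y'.
Proof.
split=> [a b|a b c d h1 h2]; first by rewrite /lie_next => ->.
rewrite (Y'E h1) (Y'E h2); have := lie_next_br h1 h2; rewrite /rule => ->.
have a1 : arrow U' M a b by rewrite /arrow h1.
have a2 : arrow U' M c d by rewrite /arrow h2.
have tb := colU (unfilled_nextW h1); have td := colU (unfilled_nextW h2).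
congr (_ - _).
  case: eqP => [bc|_]; last by rewrite !mul0r.
  by rewrite Y'E' //; apply: (next_trans idM invU top a1); rewrite bc.
case: eqP => [da|_]; last by rewrite !mul0r.
by rewrite Y'E' //; apply: (next_trans idM invU top a2); rewrite da.
Qed.

(** The corrected family is rational in the old one. This keeps the canonical pairs of earlier steps
    commuting with it. *)
Lemma lie_next_comm (w : F) (a b : 'I_n) : (forall c d, br w (Y c d) = 0) ->
  br w (Y' a b) = 0.
Proof.
move=> h; rewrite /lie_next; case: ifP => _; first exact: (br0r brP).
have comM x y : br w x = 0 -> br w y = 0 -> br w (x * y) = 0.
  by move=> hx hy; rewrite (brMr brP) hx hy mulr0 mul0r addr0.
have comV x : br w x = 0 -> br w x^-1 = 0.
  by move=> hx; apply: (br0C brP); apply: (brVl brP); apply: (br0C brP).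
case: ifP => _; first exact: h.
have hV : br w (Y k t)^-1 = 0 by apply: (comV).
case: ifP => _.
  rewrite (brDr brP) h add0r; apply: (comM) => //.
  by rewrite (br_sumr brP); apply: big1 => c _; exact: comM.
by rewrite (brBr brP) h (_ : br w (_ / _) = 0) ?subrr //; do ?apply: (comM).
Qed.

Lemma lie_next_q a x b : U k x -> U x t -> br (Y' a b) (Y x t) = 0.
Proof.
move=> kx xt.
have [h|/negPf h] := boolP (U' a b); last by rewrite /lie_next h (br0l brP).
have Uab := unfilled_nextW h.
have a1 : arrow U' M a b by rewrite /arrow h.
have xk : x != k by apply/eqP => e; move: kx; rewrite e Ulast.
rewrite Y'E // -/(u x).
have [bt|bt] := eqVneq b t; first by rewrite genC // col_col.
have [ak|ak] := eqVneq a k.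
  rewrite (genR _ ak) row_col (_ : b == x = false) ?andbF ?mul0r //.
  by apply/eqP => e; have := row_col' a1 ak; rewrite e xt.
have [bk|bk] := eqVneq b k.
  by rewrite (genE' bk ak) br_genE_col // -bk.
rewrite (genA' bt ak bk) br_genA_col //.
by case: (b =P x) => [->|]; rewrite ?andbF ?mul0r // kx andbF mul0r.
Qed.

Lemma lie_next_p a x b : U k x -> U x t -> br (Y' a b) (Y k x) = 0.
Proof.
move=> kx xt.
have [h|/negPf h] := boolP (U' a b); last by rewrite /lie_next h (br0l brP).
have Uab := unfilled_nextW h.
have a1 : arrow U' M a b by rewrite /arrow h.
rewrite Y'E // -/(r x).
have [bt|bt] := eqVneq b t.
  rewrite genC // col_row (_ : x == a = false) ?andbF ?mul0r ?oppr0 //.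
  by apply/eqP => e; have := col_row' a1 bt; rewrite -e kx.
have [ak|ak] := eqVneq a k; first by rewrite (genR _ ak) row_row.
have [bk|bk] := eqVneq b k.
  have Uak : U a k by rewrite -bk.
  by rewrite (genE' bk ak) br_genE_row // kx xt mul0r.
by rewrite (genA' bt ak bk) br_genA_row // kx xt mul0r oppr0.
Qed.

Lemma top_pq x y : U k x -> U y t -> br (Y k x) (Y y t) = (x == y)%:R * z.
Proof. by move=> kx yt; rewrite -/(r x) row_col kx yt. Qed.

Lemma top_pp x y : br (Y k x) (Y k y) = 0.
Proof. exact: row_row. Qed.

Lemma top_qq x y : br (Y x t) (Y y t) = 0.
Proof. exact: col_col. Qed.

Lemma br_topl a b : br z (Y a b) = 0.
Proof. exact: brzY. Qed.

(** The correction is triangular and can be undone: column t and row k come back directly, then the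
    minors, and column k last because [sumE] involves entries of the other columns. *)
Lemma lie_next_gen (G : F -> Prop) :
  (forall x y, G x -> G y -> G (x + y)) ->
  (forall x y, G x -> G y -> G (x * y)) -> G (-1) -> G 0 ->
  G z -> G z^-1 -> (forall a, U k a -> U a t -> G (Y k a) /\ G (Y a t)) ->
  (forall a b, G (Y' a b)) -> forall a b, G (Y a b).
Proof.
move=> GD GM G1 G0 Gz Gz1 Gpq GY'.
have GB x y : G x -> G y -> G (x - y).
  by move=> hx hy; rewrite -[y]mul1r -mulNr; apply: (GD) => //; apply: (GM).
have Gcol a : G (u a).
  rewrite /u; have [at_|/Y0 -> //] := boolP (U a t).
  have [ka|nka] := boolP (U k a); first by case: (Gpq a ka at_).
  have [-> //|ak] := eqVneq a k.
  have h : U' a t by rewrite /unfilled_next at_ xpair_eqE (negPf ak) (negPf nka) andbF.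
  by have := GY' a t; rewrite Y'E // genC.
have Grow b : G (r b).
  rewrite /r; have [kb|/Y0 -> //] := boolP (U k b).
  have [bt|nbt] := boolP (U b t); first by case: (Gpq b kb bt).
  have [-> //|bk] := eqVneq b t.
  have h : U' k b by rewrite /unfilled_next kb xpair_eqE (negPf bk) (negPf nbt) !andbF.
  by have := GY' k b; rewrite Y'E // genR.
have Ggen a b : b != k -> G (Y a b).
  move=> bk; have [ab|/Y0 -> //] := boolP (U a b).
  have [->|bt] := eqVneq b t; first exact: (Gcol a).
  have [->|ak] := eqVneq a k; first exact: (Grow b).
  have h : U' a b by rewrite /unfilled_next ab xpair_eqE (negPf ak) (negPf bt).
  have := GY' a b; rewrite Y'E // genA' // => h'.
  rewrite -[Y a b](subrK (u a * r b / z)); apply: (GD) => //.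
  by apply: (GM) => //; apply: (GM).
move=> a b; have [bk|bk] := eqVneq b k; last exact: Ggen.
subst b; have [ak|/Y0 -> //] := boolP (U a k).
have nak : a != k by apply/eqP => e; move: ak; rewrite e Ulast.
have h : U' a k.
  by rewrite /unfilled_next ak xpair_eqE (negPf nak) [k == t]eq_sym (negPf t_neq_k).
have := GY' a k; rewrite Y'E // genE' // => h'.
rewrite -[Y a k](addrK (sumE a / z)); apply: (GB) => //.
apply: (GM) => //; rewrite /sumE; elim/big_ind: _ => // c ck.
by apply: (GM); [exact: Gcol | exact: Ggen].
Qed.

End PoissonStep.

(** * Derivations of the fraction field *)

Definition is_derivation (F : comNzRingType) (D : F -> F) :=
  (forall x y, D (x + y) = D x + D y) /\
  (forall x y, D (x * y) = x * D y + D x * y).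

Section FracDeriv.
Variables (K : fieldType) (n : nat).
Local Notation Pol := (Pol K n).
Local Notation Frac := (Frac K n).
Local Notation "x %:F" := (@FracField.tofrac _ x : Frac).

(** [fderiv] is computed on the representative chosen by [repr], so the witnesses are its numerator
    and denominator. *)
Lemma frac_numden (x : Frac) :
  exists a b : Pol, [/\ b != 0, x = a%:F / b%:F & forall k,
     fderiv k x = (a^`M(k) * b - a * b^`M(k))%:F / (b ^+ 2)%:F].
Proof.
exists (\n_(repr x)), (\d_(repr x)); split=> //; first exact: denom_ratioP.
set r := repr x.
have d0 : \d_r != 0 := denom_ratioP r.
apply: (@mulIf _ ((\d_r)%:F)); first by rewrite tofrac_eq0.
rewrite mulfVK ?tofrac_eq0 // -[x]reprK -/r.
have -> : (\d_r)%:F = \pi_({fraction Pol})%qT (Ratio \d_r 1).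
  by unlock FracField.tofrac.
have -> : (\n_r)%:F = \pi_({fraction Pol})%qT (Ratio \n_r 1).
  by unlock FracField.tofrac.
rewrite -[_ * _]/(FracField.mul _ _) piE.
apply/eqP; rewrite piE /FracField.equivf /= /FracField.mulf.
by rewrite !numden_Ratio ?mulf_neq0 ?oner_eq0 // !mulr1 mulrC.
Qed.

Let alg1 (F : fieldType) (m d a b m' d' a' b' : F) :
  d != 0 -> b != 0 -> m * b = a * d ->
  m' * b + m * b' = a' * d + a * d' ->
  (m' * d - m * d') / d ^+ 2 = (a' * b - a * b') / b ^+ 2.
Proof.
move=> d0 b0 e e'; apply/eqP; rewrite eqr_div ?expf_neq0 //; apply/eqP.
have -> : (m' * d - m * d') * b ^+ 2 = (m' * b + m * b') * b * d - (m * b) * (b'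
  * d + b * d') by ring.
by rewrite e e'; ring.
Qed.

(** Independence of the representative: the cross-multiplied identity and its derivative together
    force the two quotient formulas to agree. *)
Lemma fderiv_div k (a b : Pol) : b != 0 ->
  fderiv k (a%:F / b%:F) = (a^`M(k) * b - a * b^`M(k))%:F / (b ^+ 2)%:F.
Proof.
move=> b0; have [n' [d [d0 e ->]]] := frac_numden (a%:F / b%:F).
have e1 : n' * b = a * d.
  apply/eqP; rewrite -tofrac_eq !tofracM -eqr_div ?tofrac_eq0 //.
  by rewrite e.
have e3 : n'%:F * b%:F = a%:F * d%:F by rewrite -!tofracM e1.
have e2 : (n'^`M(k))%:F * b%:F + n'%:F * (b^`M(k))%:F
    = (a^`M(k))%:F * d%:F + a%:F * (d^`M(k))%:F.
  by rewrite -!tofracM -!tofracD -!mderivM e1.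
rewrite !tofracXn !tofracB !tofracM.
by apply: alg1; rewrite ?tofrac_eq0.
Qed.

Lemma fderiv_tofrac k (a : Pol) : fderiv k (a%:F) = (a^`M(k))%:F.
Proof.
have d1 : (1 : Pol)^`M(k) = 0 by rewrite -mpolyC1 mderivC.
have := @fderiv_div k a 1 (oner_neq0 _); rewrite tofrac1 divr1 => ->.
by rewrite d1 mulr0 subr0 mulr1 expr1n tofrac1 divr1.
Qed.

Let alg2 (F : fieldType) (a b c d a' b' c' d' : F) : b != 0 -> d != 0 ->
  ((a' * d + a * d' + (c' * b + c * b')) * (b * d) - (a * d + c * b) * (b' * d +
    b * d')) / (b * d) ^+ 2
  = (a' * b - a * b') / b ^+ 2 + (c' * d - c * d') / d ^+ 2.
Proof. by move=> b0 d0; field; rewrite b0 d0. Qed.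

Let alg3 (F : fieldType) (a b c d a' b' c' d' : F) : b != 0 -> d != 0 ->
  ((a' * c + a * c') * (b * d) - (a * c) * (b' * d + b * d')) / (b * d) ^+ 2
  = a / b * ((c' * d - c * d') / d ^+ 2) + (a' * b - a * b') / b ^+ 2 * (c / d).
Proof. by move=> b0 d0; field; rewrite b0 d0. Qed.

Lemma fderiv_derivation k : is_derivation (@fderiv K n k).
Proof.
split=> x y; have [a [b [b0 ex dx]]] := frac_numden x;
  have [c [d [d0 ey dy]]] := frac_numden y; rewrite dx dy ex ey.
- have -> : a%:F / b%:F + c%:F / d%:F = (a * d + c * b)%:F / (b * d)%:F :> Frac.
    by rewrite tofracD !tofracM addf_div ?tofrac_eq0.
  rewrite fderiv_div ?mulf_neq0 // !(mderivD, mderivM) !tofracXn !(tofracB,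
    tofracD, tofracM).
  by apply: alg2; rewrite tofrac_eq0.
- have -> : a%:F / b%:F * (c%:F / d%:F) = (a * c)%:F / (b * d)%:F :> Frac.
    by rewrite !tofracM mulf_div.
  rewrite fderiv_div ?mulf_neq0 // !(mderivD, mderivM) !tofracXn !(tofracB,
    tofracD, tofracM).
  by apply: alg3; rewrite tofrac_eq0.
Qed.

End FracDeriv.

(** * Derivations and the chain rule for polynomial evaluation *)

Section Derivation.
Variables (F : comNzRingType) (D : F -> F).
Hypothesis DP : is_derivation D.

Lemma derD x y : D (x + y) = D x + D y. Proof. exact: DP.1. Qed.
Lemma derM x y : D (x * y) = x * D y + D x * y. Proof. exact: DP.2. Qed.

Lemma der0 : D 0 = 0.
Proof. by apply: (addrI (D 0)); rewrite -derD !addr0. Qed.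

Lemma der1 : D 1 = 0.
Proof. by apply: (addrI (D 1)); rewrite addr0 -{3}[1]mulr1 derM mulr1 mul1r. Qed.

Lemma derX x m : D (x ^+ m) = x ^+ m.-1 * D x *+ m.
Proof.
elim: m => [|m IH]; first by rewrite expr0 der1 mulr0n.
rewrite exprS derM IH; case: m {IH} => [|m];
  first by rewrite mulr0n mulr0 add0r expr0 mulr1 mul1r mulr1n.
by rewrite /= mulrnAr mulrA -exprS [D x * _]mulrC [RHS]mulrSr.
Qed.

End Derivation.

Section ChainRule.
Variables (K : fieldType) (F : comNzRingType) (c : {rmorphism K -> F}) (D : F -> F).
Hypothesis DP : is_derivation D.
Hypothesis Dc : forall a, D (c a) = 0.
Variables (N : nat) (v : 'I_N -> F).

Lemma der_mmap (f : {mpoly K[N]}) :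
  D (mmap c v f) = \sum_k mmap c v f^`M(k) * D (v k).
Proof.
elim/mpolyind: f => [|a m f _ _ IH].
  by rewrite mmap0 (der0 DP) big1 // => k _; rewrite mderiv0 mmap0 mul0r.
rewrite mmapD (derD DP) IH -[RHS]/(\sum_k _).
under [RHS]eq_bigr do rewrite mderivD mmapD mulrDl.
rewrite big_split /=; congr (_ + _).
rewrite mmapZ mmapX (derM DP) Dc mul0r addr0.
under eq_bigr do rewrite mderivZ mderivX mmapZ -mulrA.
rewrite -mulr_sumr; congr (_ * _).
rewrite /mmap1.
(* Product rule along a duplicate-free list. The truncated subtraction in m - U_(k) is harmless
   because the term carries the multiplicity m k. *)
have prodE (r : seq 'I_N) : uniq r -> D (\prod_(i <- r) v i ^+ m i) =
   \sum_(k <- r) (\prod_(i <- r) v i ^+ (m - U_(k))%MM i) *+ m k * D (v k).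
  elim: r => [|i r IHr] /=; first by rewrite !big_nil (der1 DP).
  case/andP=> ir ur; rewrite big_cons (derM DP) IHr // big_cons addrC.
  congr (_ + _).
    have -> : \prod_(j <- i :: r) v j ^+ (m - U_(i))%MM j
            = v i ^+ (m i).-1 * \prod_(j <- r) v j ^+ m j.
      rewrite big_cons mnmBE mnm1E eqxx subn1; congr (_ * _).
      apply: eq_big_seq => j jr; rewrite mnmBE mnm1E.
      by case: eqP => [e|_]; [rewrite e jr in ir | rewrite subn0].
    rewrite (derX DP).
    by rewrite !mulrnAl; congr (_ *+ _); ring.
  rewrite mulr_sumr; apply: eq_big_seq => k kr.
  rewrite big_cons mnmBE mnm1E; case: eqP => [e|_]; first by rewrite -e kr in ir.
  by rewrite subn0 mulrA mulrnAr.
rewrite prodE ?index_enum_uniq //; apply: eq_bigr => k _; congr (_ * _).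
rewrite scaler_nat mmapMn mmapX; rewrite /mmap1 //.
Qed.
End ChainRule.

(** * Polynomials in a prescribed set of variables *)

Section VarsIn.
Variables (K : fieldType) (n : nat).
Local Notation Pol := (Pol K n).
Implicit Types (P : pred (place n)) (f g : Pol).

Lemma vars_inW P P' f : (forall p, P p -> P' p) -> vars_in P f -> vars_in P' f.
Proof. by move=> h H m mf p np; apply: (H _ mf); apply: contra np; apply: h. Qed.

Lemma vars_in0 P : vars_in P (0 : Pol).
Proof. by move=> m; rewrite msupp0. Qed.

Lemma vars_inC P (c : K) : vars_in P (c%:MP : Pol).
Proof.
move=> m; rewrite msuppC; case: eqP => // _; rewrite inE => /eqP -> p _.
by rewrite mnm0E.
Qed.

Lemma vars_in1 P : vars_in P (1 : Pol).
Proof. by rewrite -mpolyC1; apply: vars_inC. Qed.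

Lemma vars_inD P f g : vars_in P f -> vars_in P g -> vars_in P (f + g).
Proof.
move=> hf hg m /msuppD_le; rewrite mem_cat => /orP[]; [exact: hf | exact: hg].
Qed.

Lemma vars_inM P f g : vars_in P f -> vars_in P g -> vars_in P (f * g).
Proof.
move=> hf hg m /msuppM_le /allpairsP[[m1 m2] /= [h1 h2 ->]] p np.
by rewrite mnmDE (hf _ h1 _ np) (hg _ h2 _ np).
Qed.

Lemma vars_inX P f k : vars_in P f -> vars_in P (f ^+ k).
Proof.
move=> hf; elim: k => [|k IH]; first by rewrite expr0; apply: vars_in1.
by rewrite exprS; apply: vars_inM.
Qed.

Lemma vars_in_prod P (I : Type) (r : seq I) (Q : pred I) (F : I -> Pol) :
  (forall i, Q i -> vars_in P (F i)) -> vars_in P (\prod_(i <- r | Q i) F i).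
Proof.
move=> h; elim/big_rec: _ => [|i f Qi]; first exact: vars_in1.
by apply: vars_inM; apply: h.
Qed.

Lemma vars_in_y P p : P p -> vars_in P (y K p).
Proof.
move=> Pp m; rewrite msuppX inE => /eqP -> q nq.
rewrite mnm1E; case: eqP => // /enum_rank_inj e.
by rewrite e (negPf nq) in Pp.
Qed.

Lemma mderiv_vars_in P p f : vars_in P f -> ~~ P p -> f^`M(vidx p) = 0.
Proof.
move=> hf np; apply/mpolyP => m; rewrite mcoeff_deriv mcoeff0.
have [h|/memN_msupp_eq0 ->] := boolP (m + U_(vidx p) \in msupp f)%MM.
  by have := hf _ h _ np; rewrite mnmDE mnm1E eqxx addn1.
by rewrite mul0rn.
Qed.
End VarsIn.

(** * The Poisson bracket on the fraction field and its Casimirs *)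

Section Bracket.
Variables (K : fieldType) (n : nat) (M : {set place n}).
Local Notation Pol := (Pol K n).
Local Notation Frac := (Frac K n).
Local Notation "x %:F" := (@FracField.tofrac _ x : Frac).
Local Notation br := (@fbr K n M).

Lemma lbrC (p q : place n) : lbr K M q p = - lbr K M p q.
Proof. by rewrite /lbr opprB. Qed.

Lemma fbr_poisson : is_poisson br.
Proof.
have DP k := @fderiv_derivation K n k.
split=> [x z|x z w|x z w]; rewrite /fbr.
- rewrite exchange_big -sumrN /=; apply: eq_bigr => p _; rewrite -sumrN.
  apply: eq_bigr => q _; rewrite lbrC tofracN mulrN; congr (- _).
  by rewrite [X in X * _]mulrC.
- rewrite -big_split /=; apply: eq_bigr => p _; rewrite -big_split /=.
  by apply: eq_bigr => q _; rewrite (derD (DP _)) !mulrDl.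
- rewrite mulr_sumr mulr_suml -big_split /=; apply: eq_bigr => p _.
  rewrite mulr_sumr mulr_suml -big_split /=; apply: eq_bigr => q _.
  by rewrite (derM (DP _)); ring.
Qed.

Lemma fderiv_y (p q : place n) : fderiv (vidx p) (y K q)%:F = (p == q)%:R :> Frac.
Proof.
rewrite fderiv_tofrac /y mderivX mnm1E (inj_eq enum_rank_inj) eq_sym.
case: eqP => [->|_]; last by rewrite scale0r tofrac0.
by rewrite scale1r (_ : (_ - _)%MM = 0%MM) ?mpolyX0 ?tofrac1 //; apply/mnmP => i;
  rewrite mnmBE subnn mnm0E.
Qed.

Lemma fbr_yl p w : inL M p ->
  br (y K p)%:F w = \sum_(q | inL M q) fderiv (vidx q) w * (lbr K M p q)%:F.
Proof.
move=> Lp; rewrite /fbr (bigD1 p) //= [X in _ + X]big1 ?addr0 => [|q /andP[_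
  /negPf qp]].
  by apply: eq_bigr => q _; rewrite fderiv_y eqxx mul1r.
by rewrite big1 // => r _; rewrite fderiv_y qp !mul0r.
Qed.

Lemma fbr_yy p q : inL M p -> inL M q ->
  br (y K p)%:F (y K q)%:F = (lbr K M p q)%:F.
Proof.
move=> Lp Lq; rewrite fbr_yl // (bigD1 q) //= [X in _ + X]big1 ?addr0.
  by rewrite fderiv_y eqxx mul1r.
by move=> r /andP[_ /negPf rq]; rewrite fderiv_y rq mul0r.
Qed.

Lemma fbr_gen x w : br x w =
  \sum_(p | inL M p) fderiv (vidx p) x * br (y K p)%:F w.
Proof.
apply: eq_bigr => p Lp; rewrite fbr_yl // mulr_sumr.
by apply: eq_bigr => q _; rewrite mulrA.
Qed.

Lemma fbr_casimir x : (forall p, inL M p -> br x (y K p)%:F = 0) ->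
  forall w, br x w = 0.
Proof.
move=> h w; apply: (br0C fbr_poisson); rewrite fbr_gen big1 // => p Lp.
by rewrite (br0C fbr_poisson (h _ Lp)) mulr0.
Qed.

Lemma fbr_const (c : K) w : br (c%:MP : Pol)%:F w = 0.
Proof.
rewrite fbr_gen big1 // => p _.
by rewrite fderiv_tofrac mderivC tofrac0 mul0r.
Qed.

Lemma fbr_derivation w : is_derivation (fun x => br x w).
Proof.
by split=> x z; [exact: (brDl fbr_poisson) | exact: (brMl fbr_poisson)].
Qed.

End Bracket.

(** * Fractions whose denominators are monomials in the central elements *)

Section Localization.
Variables (K : fieldType) (n : nat).
Local Notation Pol := (Pol K n).
Local Notation Frac := (Frac K n).
Local Notation "x %:F" := (@FracField.tofrac _ x : Frac).
Implicit Types (zs : seq Pol) (P : pred (place n)).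

(** Exponents are indexed by all naturals, so appending to [zs] does not change their type. *)
Definition zmon zs (m : Pol) :=
  exists e : nat -> nat, m = \prod_(j < size zs) zs`_j ^+ e j.

(** Tracking the variables of the numerator lets one notion serve both the localization ([P] is
    [inL M]) and the control of leading terms ([P] is [above p]). *)
Definition inLoc zs P (x : Frac) :=
  exists f m, [/\ zmon zs m, vars_in P f & x = f%:F / m%:F].

Lemma zmon1 zs : zmon zs 1.
Proof. by exists (fun=> 0%N); rewrite big1. Qed.

Lemma zmonM zs m m' : zmon zs m -> zmon zs m' -> zmon zs (m * m').
Proof.
move=> [e ->] [e' ->]; exists (fun j => e j + e' j)%N.
by rewrite -big_split; apply: eq_bigr => j _; rewrite exprD.
Qed.

Lemma zmon_neq0 zs m : (forall z, z \in zs -> z != 0) -> zmon zs m -> m != 0.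
Proof.
move=> h [e ->]; apply/prodf_neq0 => j _; rewrite expf_neq0 // h //.
exact: mem_nth.
Qed.

Lemma zmon_vars zs P m : (forall z, z \in zs -> vars_in P z) -> zmon zs m ->
  vars_in P m.
Proof.
move=> h [e ->]; apply: vars_in_prod => j _; apply: vars_inX; apply: h.
exact: mem_nth.
Qed.

Lemma zmon_rcons zs z m : zmon zs m -> zmon (rcons zs z) m.
Proof.
move=> [e ->]; exists (fun j => if (j < size zs)%N then e j else 0%N).
rewrite size_rcons big_ord_recr /= ltnn expr0 mulr1; apply: eq_bigr => j _.
by rewrite nth_rcons ltn_ord.
Qed.

Lemma zmon_last zs z : zmon (rcons zs z) z.
Proof.
exists (fun j => (j == size zs) : nat); rewrite size_rcons big_ord_recr /= big1.
  by rewrite mul1r nth_rcons ltnn eqxx expr1.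
by move=> j _; rewrite (ltn_eqF (ltn_ord j)) expr0.
Qed.

Section Closure.
Variables (zs : seq Pol) (P : pred (place n)).
Hypothesis zs_neq0 : forall z, z \in zs -> z != 0.
Hypothesis zs_vars : forall z, z \in zs -> vars_in P z.

Lemma inLoc_pol f : vars_in P f -> inLoc zs P f%:F.
Proof. by exists f, 1; split=> //; [exact: zmon1 | rewrite tofrac1 divr1]. Qed.

Lemma inLoc_inv m : zmon zs m -> inLoc zs P (m%:F)^-1.
Proof.
by exists 1, m; split=> //; [exact: vars_in1 | rewrite tofrac1 mul1r].
Qed.

Lemma inLocM x w : inLoc zs P x -> inLoc zs P w -> inLoc zs P (x * w).
Proof.
move=> [f [m [hm hf ->]]] [g [m' [hm' hg ->]]]; exists (f * g), (m * m').
split; [exact: zmonM | exact: vars_inM |].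
by rewrite !tofracM mulf_div.
Qed.

Lemma inLocD x w : inLoc zs P x -> inLoc zs P w -> inLoc zs P (x + w).
Proof.
move=> [f [m [hm hf ->]]] [g [m' [hm' hg ->]]]; exists (f * m' + g * m), (m * m').
split; first exact: zmonM.
  by apply: vars_inD; apply: vars_inM => //; apply: (zmon_vars zs_vars).
by rewrite tofracD !tofracM addf_div // tofrac_eq0 (zmon_neq0 zs_neq0).
Qed.

Lemma inLocC (c : K) : inLoc zs P (c%:MP : Pol)%:F.
Proof. by apply: inLoc_pol; apply: vars_inC. Qed.

Lemma inLoc0 : inLoc zs P 0.
Proof. by rewrite -(tofrac0 Pol); apply: inLoc_pol; apply: vars_in0. Qed.

Lemma inLocN x : inLoc zs P x -> inLoc zs P (- x).
Proof.
move=> hx; rewrite -mulN1r; apply: inLocM => //.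
by rewrite -(tofrac1 Pol) -tofracN -mpolyC1 -mpolyCN; exact: inLocC.
Qed.

End Closure.

Lemma inLocW zs P P' x : (forall p, P p -> P' p) -> inLoc zs P x -> inLoc zs P' x.
Proof. by move=> h [f [m [hm hf ->]]]; exists f, m; split=> //; apply: vars_inW hf. Qed.

Lemma inLoc_rcons zs z P x : inLoc zs P x -> inLoc (rcons zs z) P x.
Proof. by move=> [f [m [hm hf ->]]]; exists f, m; split=> //; apply: zmon_rcons. Qed.

End Localization.

(** * Processing the diagram *)

Lemma eq_divr (F : fieldType) (m x z : F) : m != 0 -> m * x = z -> x = z / m.
Proof. by move=> m0 <-; rewrite mulrC mulKf. Qed.

Section State.
Variables (K : fieldType) (n : nat) (M : {set place n}).
Local Notation Pol := (Pol K n).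
Local Notation Frac := (Frac K n).
Local Notation "x %:F" := (@FracField.tofrac _ x : Frac).
Local Notation br := (@fbr K n M).
Let brP := fbr_poisson K M.

Definition Mrel : rel 'I_n := fun a b => (a, b) \in M.

(** Bracketing with y_(b,b') moves a place of M to the left along its row, and bracketing with
    y_(a',a) moves it down its column. *)
Lemma ideal_placesP : is_ideal M -> ideal_places Mrel.
Proof.
move=> [hA hM]; split=> [a b /hA //|a b a' b' Mab].
rewrite leq_eqVlt => /orP[/eqP/val_inj <-|aa'].
  rewrite leq_eqVlt => /orP[/eqP/val_inj -> //|bb].
  by have [h _] := hM a b b b' Mab bb; apply: h.
have [_ /(_ (eqxx a)) Ma'b] := hM a b a' a Mab aa'.
rewrite leq_eqVlt => /orP[/eqP/val_inj -> //|bb].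
by have [h _] := hM a' b b b' Ma'b bb; apply: h.
Qed.

Definition above (p : place n) : pred (place n) :=
  fun q => inL M q && gtA q p.

Lemma gtA_trans : transitive (@gtA n).
Proof. by move=> [a b] [c d] [e f]; rewrite /gtA /= -!val_eqE /=; lia. Qed.

(** Here [b] is a Kronecker delta. Both mixed brackets are required, which makes the condition
    symmetric in the two pairs. *)
Definition canonical (x y : Frac * Frac) (b : bool) :=
  [/\ br x.1 y.1 = 0, br x.2 y.2 = 0, br x.1 y.2 = b%:R & br y.1 x.2 = b%:R].

(* [zs] lists z_1, z_2, ... and [pq] the canonical pairs found so far; [pd_gen]
   says that these and [Y] generate the localization of K[L^*] at [zs]. *)
Record process_data (U : rel 'I_n) (Sq : seq (place n)) (t : nat)
    (zs : seq Pol) (pq : seq (Frac * Frac)) (Y : 'I_n -> 'I_n -> Frac) : Prop :=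
ProcessData {
  pd_inv : unfilled_inv Mrel t U;
  pd_lie : lie_family Mrel U br Y;
  pd_size : size zs = size Sq;
  pd_neq0 : forall z, z \in zs -> z != 0;
  pd_inL : forall z, z \in zs -> vars_in (inL M) z;
  pd_above : forall z a b, z \in zs -> U a b -> vars_in (above (a, b)) z;
  pd_casimir : forall z w, z \in zs -> br z%:F w = 0;
  pd_form : forall i p0, (i < size zs)%N -> exists (e : nat -> nat) (P : Pol),
    vars_in (above (nth p0 Sq i)) P /\
    zs`_i = y K (nth p0 Sq i) * \prod_(j < i) zs`_j ^+ e j + P;
  pd_diff : forall i j p0, (j <= i < size zs)%N ->
    (zs`_j^`M(vidx (nth p0 Sq i)) == 0) = (j != i);
  pd_xi : forall p, p \in Sq -> inL M p;
  pd_lead : forall a b, U a b -> inLoc zs (above (a, b)) (Y a b - (y K (a, b))%:F);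
  pd_canonical : forall i j, (i < size pq)%N -> (j < size pq)%N ->
    canonical (nth (0, 0) pq i) (nth (0, 0) pq j) (i == j);
  pd_comm : forall x a b, x \in pq -> br x.1 (Y a b) = 0 /\ br x.2 (Y a b) = 0;
  pd_loc : forall x, x \in pq -> inLoc zs (inL M) x.1 /\ inLoc zs (inL M) x.2;
  pd_gen : forall G : Frac -> Prop,
    (forall x w, G x -> G w -> G (x + w)) ->
    (forall x w, G x -> G w -> G (x * w)) ->
    (forall c : K, G (c%:MP : Pol)%:F) ->
    (forall z, z \in zs -> G z%:F /\ G (z%:F)^-1) ->
    (forall x, x \in pq -> G x.1 /\ G x.2) ->
    (forall a b, G (Y a b)) ->
    forall p, inL M p -> G (y K p)%:F
}.

Section ProcessStep.
Hypothesis idM : ideal_places Mrel.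
Variables (U : rel 'I_n) (Sq : seq (place n)) (t0 : nat) (zs : seq Pol).
Variables (pq : seq (Frac * Frac)) (Y : 'I_n -> 'I_n -> Frac) (k t : 'I_n).
Hypothesis pd : process_data U Sq t0 zs pq Y.
Hypothesis top : top_unfilled U k t.
Let Ukt : U k t. Proof. by case: top. Qed.
Let invU : unfilled_inv Mrel t U.
Proof.
apply: unfilled_inv_weaken (pd_inv pd) _ _; first exact: (unf_col (pd_inv pd) Ukt).
by move=> a b /(proj2 top)[/ltnW|[->]].
Qed.
Local Notation U' := (unfilled_next U k t).
Local Notation Y' := (lie_next U Y k t).

Let U_inL a b : U a b -> inL M (a, b).
Proof.
move=> ab; rewrite /inL /inA /= (unf_lt invU ab).
exact: (unf_notM invU ab).
Qed.

Let zs0 : forall z, z \in zs -> z != 0 := pd_neq0 pd.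

Let Y_above a b c d : U c d -> gtA (a, b) (c, d) -> inLoc zs (above (c, d)) (Y a b).
Proof.
move=> cd h; have [ab|/(pd_lie pd).1 ->] := boolP (U a b); last exact: inLoc0.
rewrite -[Y a b](subrK (y K (a, b))%:F); apply: inLocD => //.
- by move=> z zz; apply: (pd_above pd).
- apply: inLocW (pd_lead pd ab) => p /andP[p1 p2].
  by rewrite /above p1 (gtA_trans p2).
- by apply: inLoc_pol; apply: vars_in_y; rewrite /above h U_inL.
Qed.

(** Y_kt is y_kt plus a fraction in greater variables with a monomial denominator m. Clearing m
    gives the next central polynomial, already in the form demanded of z_i. *)
Lemma top_form : exists m f, [/\ zmon zs m, vars_in (above (k, t)) f
  & m%:F * Y k t = (y K (k, t) * m + f)%:F].
Proof.
have [f [m [hm hf e]]] := pd_lead pd Ukt.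
exists m, f; split=> //; have m0 : m%:F != 0 :> Frac.
  by rewrite tofrac_eq0; apply: zmon_neq0 hm.
rewrite tofracD tofracM -[Y k t](subrK (y K (k, t))%:F) e mulrDr addrC.
by rewrite mulrC mulrCA mulfV // mulr1.
Qed.

Let not_above_top : ~~ above (k, t) (k, t).
Proof. by rewrite /above /gtA /= !ltnn andbF andbF. Qed.

(** Neither m nor f contains y_kt. As m is nonzero, this gives the nonzero diagonal entry of the
    triangular Jacobian recorded in [pd_diff]. *)
Lemma mderiv_form m f : zmon zs m -> vars_in (above (k, t)) f ->
  (y K (k, t) * m + f)^`M(vidx (k, t)) = m.
Proof.
move=> hm hf; rewrite mderivD mderivM (mderiv_vars_in hf) // addr0.
rewrite (mderiv_vars_in (P := above (k, t)) (f := m)) //; last first.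
  by apply: (zmon_vars _ hm) => z zz; apply: (pd_above pd).
rewrite mulr0 addr0; apply/eqP; rewrite -tofrac_eq; apply/eqP.
by rewrite tofracM -fderiv_tofrac fderiv_y eqxx mul1r.
Qed.

Lemma form_neq0 m f : zmon zs m -> vars_in (above (k, t)) f ->
  y K (k, t) * m + f != 0.
Proof.
move=> hm hf; apply: contraNneq (zmon_neq0 zs0 hm) => e.
by rewrite -(mderiv_form hm hf) e mderiv0.
Qed.

Let pq' z := pq ++ [seq (Y k a, Y a t / z) | a <- enum 'I_n & U k a && U a t].

(** The elements commuting with Y_kt are closed under sums and products, so by [pd_gen] only
    generators matter: constants, earlier Casimirs and their inverses, canonical pairs, and the
    family Y. *)
Lemma top_casimir : Y k t != 0 -> forall w, br (Y k t) w = 0.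
Proof.
move=> z0; apply: fbr_casimir.
have cC x : br (Y k t) x = 0 <-> br x (Y k t) = 0.
  by split; apply: (br0C brP).
apply: (pd_gen pd (G := fun x => br (Y k t) x = 0)).
- by move=> x w hx hw; rewrite (brDr brP) hx hw addr0.
- by move=> x w hx hw; rewrite (brMr brP) hx hw mulr0 mul0r addr0.
- by move=> c; apply/cC; apply: fbr_const.
- move=> z zz; have h := pd_casimir pd (Y k t) zz.
  by split; apply/cC => //; apply: (brVl brP).
- by move=> x /(pd_comm pd) h; have [h1 h2] := h k t; split; apply/cC.
- by move=> a b; apply: (br_topl idM invU top brP (pd_lie pd)).
Qed.

Lemma process_step : exists z pq1,
  process_data U' (rcons Sq (k, t)) t (rcons zs z) pq1 Y'.
Proof.
have [m [f [hm hf e]]] := top_form.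
have z0 := form_neq0 hm hf.
set z := _ + f in e z0; exists z, (pq' (Y k t)).
have m0 : m%:F != 0 :> Frac by rewrite tofrac_eq0; apply: zmon_neq0 hm.
have Y0 : Y k t != 0.
  apply: contra_neq z0 => h; apply/eqP; rewrite -tofrac_eq0.
  by rewrite -e h mulr0.
have ez : Y k t = z%:F / m%:F := eq_divr m0 e.
have zs0' w : w \in rcons zs z -> w != 0.
  by rewrite mem_rcons inE => /predU1P[->|/zs0].
have lieY := pd_lie pd.
have cas w : br (Y k t) w = 0 by apply: top_casimir.
have m_cas w : br m%:F w = 0.
  case: hm => e0 ->; rewrite (_ : (_ _)%:F = \prod_(j < size zs) (zs`_j ^+ e0
    j)%:F :> Frac);
    last by rewrite rmorph_prod.
  elim/big_rec: _ => [|j x _ IH]; first by rewrite (br1l brP).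
  apply: (brMl0 brP) IH; rewrite tofracXn; elim: (e0 j) => [|i IHi].
    by rewrite expr0 (br1l brP).
  by rewrite exprS; apply: (brMl0 brP) IHi; apply: (pd_casimir pd); apply: mem_nth.
have abs w a b : w \in rcons zs z -> U' a b -> vars_in (above (a, b)) w.
  rewrite mem_rcons inE => wz ab; have Uab := unfilled_nextW ab.
  case/predU1P: wz => [->|wz]; last by apply: (pd_above pd).
  have gt : gtA (k, t) (a, b).
    rewrite /gtA /=; case/and4P: ab => _ + _ _; rewrite xpair_eqE.
    have [->//|[-> ak]] := (proj2 top) _ _ Uab.
    by rewrite eqxx andbT ltnn /= => nak; rewrite ltn_neqAle ak andbT.
  rewrite /z; apply: vars_inD; last first.
    by apply: vars_inW hf => p /andP[p1 p2]; rewrite /above p1 (gtA_trans p2).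
  apply: vars_inM; first by apply: vars_in_y; rewrite /above U_inL.
  by apply: (zmon_vars _ hm) => v vz; apply: (pd_above pd).
have zinL w : w \in rcons zs z -> vars_in (inL M) w.
  rewrite mem_rcons inE => /predU1P[->|]; last exact: (pd_inL pd).
  rewrite /z; apply: vars_inD; last by apply: vars_inW hf => p /andP[].
  apply: vars_inM; first by apply: vars_in_y; rewrite U_inL.
  by apply: (zmon_vars _ hm); apply: (pd_inL pd).
(* The inverse of Y_kt is m / z, so it costs only the new denominator z. *)
have Vloc P : (forall w, w \in rcons zs z -> vars_in P w) -> inLoc (rcons zs z) P
  (Y k t)^-1.
  move=> hP; rewrite ez invf_div; apply: inLocM; last by apply: inLoc_inv;
    apply: zmon_last.
  by apply: inLoc_pol; apply: (zmon_vars hP); apply: zmon_rcons.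
have Y'above a b c d : U' c d -> gtA (a, b) (c, d) ->
    inLoc (rcons zs z) (above (c, d)) (Y a b).
  by move=> cd h; apply: inLoc_rcons; apply: Y_above h; apply: unfilled_nextW cd.
have mem_new x : x \in pq' (Y k t) -> x \in pq \/
    exists a, [/\ U k a, U a t & x = (Y k a, Y a t / Y k t)].
  rewrite mem_cat => /orP[]; first by left.
  case/mapP=> a; rewrite mem_filter => /andP[/andP[h1 h2] _] ->.
  by right; exists a.
have Q_cas a w : br (Y a t / Y k t) w = br (Y a t) w / Y k t by rewrite (brMVl brP).
have Q_casr a w : br w (Y a t / Y k t) = br w (Y a t) / Y k t by rewrite (brMVr brP).
have tPQ := top_pq idM invU top brP lieY Y0.
have tPP := top_pp idM invU top brP lieY Y0.
have tQQ := top_qq idM invU top brP lieY Y0.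
have canC x y b : canonical x y b -> canonical y x b.
  by case=> h1 h2 h3 h4; split=> //; apply: (br0C brP).
split.
- exact: unfilled_inv_next.
- exact: lie_family_next.
- by rewrite !size_rcons (pd_size pd).
- exact: zs0'.
- exact: zinL.
- by move=> w a b wz ab; apply: abs.
- move=> w v; rewrite mem_rcons inE => /predU1P[->|]; last exact: (pd_casimir pd).
  by rewrite -e; apply: (brMl0 brP).
- move=> i p0; rewrite size_rcons ltnS leq_eqVlt => /predU1P[->|iz].
    case: hm => e0 em; exists e0, f; rewrite {1}(pd_size pd) !nth_rcons ltnn eqxx.
    rewrite -(pd_size pd) ltnn eqxx; split=> //; rewrite /z em; congr (_ * _ + _).
    by apply: eq_bigr => j _; rewrite nth_rcons ltn_ord.
  have [e0 [P [h1 h2]]] := pd_form pd p0 iz; exists e0, P.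
  rewrite !nth_rcons -(pd_size pd) iz; split=> //; rewrite h2; congr (_ * _ + _).
  by apply: eq_bigr => j _; rewrite nth_rcons (ltn_trans (ltn_ord j)).
- move=> i j p0; rewrite size_rcons ltnS => /andP[].
  rewrite [(i <= _)%N]leq_eqVlt !nth_rcons -(pd_size pd) => ji /predU1P[ei|iz];
    last first.
    rewrite iz (leq_ltn_trans ji iz); apply: (pd_diff pd); by rewrite ji.
  move: ji; rewrite ei ltnn eqxx leq_eqVlt => /predU1P[->|jz].
    by rewrite ltnn eqxx mderiv_form // (negPf (zmon_neq0 zs0 hm)).
  rewrite jz (ltn_eqF jz); apply/eqP; apply: (mderiv_vars_in _ not_above_top).
  by apply: (pd_above pd); rewrite ?mem_nth.
- move=> p; rewrite mem_rcons inE => /predU1P[->|]; last exact: (pd_xi pd).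
  exact: U_inL.
- move=> a b ab; have Uab := unfilled_nextW ab.
  have zab w : w \in rcons zs z -> vars_in (above (a, b)) w by move=> wz; apply: abs.
  have lead : inLoc (rcons zs z) (above (a, b)) (Y a b - (y K (a, b))%:F).
    by apply: inLoc_rcons; apply: (pd_lead pd).
  have Vab := Vloc _ zab.
  (* Each product in the correction either has both factors at places greater than (a,b) or contains
     a vanishing [Y a t] or [Y c t]; the leading term is therefore unchanged. *)
  rewrite /lie_next ab /=; case: ifP => [//|/norP[bt ak]].
  have ltb : (t < b)%N by rewrite ltn_neqAle eq_sym bt (unf_col invU Uab).
  case: eqP => [bk|/eqP bk].
    subst b; rewrite addrAC; apply: (inLocD zs0' zab lead).
    apply: inLocM => //; elim/big_ind: _ => [|x w|c ck]; first exact: inLoc0.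
      exact: inLocD.
    have [ct|/lieY.1 ->] := boolP (U c t); last by rewrite mul0r; apply: inLoc0.
    apply: inLocM; apply: Y'above => //; rewrite /gtA /= ?ltb //.
    by rewrite ltn_neqAle ck (U_top_le top ct).
  rewrite addrAC; apply: (inLocD zs0' zab lead); apply: inLocN.
  apply: inLocM => //.
  have [at_|/lieY.1 ->] := boolP (U a t); last by rewrite mul0r; apply: inLoc0.
  apply: inLocM; apply: Y'above => //; rewrite /gtA /= ?ltb // eqxx.
  by rewrite [(a < k)%N]ltn_neqAle ak (U_top_le top at_) orbT.
- set s := [seq a <- enum 'I_n | U k a && U a t].
  have us : uniq s by rewrite filter_uniq // enum_uniq.
  have new a b : a \in s -> b \in s ->
      canonical (Y k a, Y a t / Y k t) (Y k b, Y b t / Y k t) (a == b).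
    rewrite !mem_filter => /andP[/andP[ka at_] _] /andP[/andP[kb bt] _].
    split=> /=; rewrite ?Q_cas ?Q_casr ?Q_cas.
    + exact: tPP.
    + by rewrite tQQ !mul0r.
    + by rewrite tPQ // mulfK.
    + by rewrite tPQ // mulfK // eq_sym.
  have cross x a : x \in pq -> canonical x (Y k a, Y a t / Y k t) false.
    move=> xpq; have [c1 c2] := pd_comm pd k a xpq; have [c3 c4] := pd_comm pd a t xpq.
    split=> //=; rewrite ?Q_casr ?Q_cas ?c4 ?c3 ?mul0r //.
    by apply: (br0C brP).
  move=> i j; rewrite size_cat size_map -/s => hi hj; rewrite !nth_cat.
  have old l : (size pq <= l < size pq + size s)%N ->
      exists2 l', (l' < size s)%N & l = (size pq + l')%N.
    by move=> /andP[h1 h2]; exists (l - size pq)%N; lia.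
  have [ip|ip] := ltnP i (size pq); have [jp|jp] := ltnP j (size pq).
  + exact: (pd_canonical pd).
  + have [|j' hj' ->] := old j; first by rewrite jp.
    rewrite addKn (nth_map k) // (_ : i == _ = false); last by apply/eqP; lia.
    by apply: cross; apply: mem_nth.
  + have [|i' hi' ->] := old i; first by rewrite ip.
    rewrite addKn (nth_map k) // (_ : (_ == j) = false); last by apply/eqP; lia.
    by apply: canC; apply: cross; apply: mem_nth.
  + have [|i' hi' ->] := old i; first by rewrite ip.
    have [|j' hj' ->] := old j; first by rewrite jp.
    rewrite !addKn !(nth_map k) // eqn_add2l -(nth_uniq k hi' hj' us).
    by apply: new; apply: mem_nth.
- move=> x a b /mem_new[xpq|[c [kc ct ->]]] /=.
    by split; apply: lie_next_comm => // c d; case: (pd_comm pd c d xpq).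
  split; first by apply: (br0C brP); apply: (lie_next_p idM invU top brP lieY).
  rewrite Q_cas (_ : br _ _ = 0) ?mul0r //.
  by apply: (br0C brP); apply: (lie_next_q idM invU top brP lieY).
- move=> x /mem_new[xpq|[c [kc ct ->]]] /=.
    by have [h1 h2] := pd_loc pd xpq; split; apply: inLoc_rcons.
  have inLY a b : inLoc (rcons zs z) (inL M) (Y a b).
    apply: inLoc_rcons; have [ab|/lieY.1 ->] := boolP (U a b); last exact: inLoc0.
    rewrite -[Y a b](subrK (y K (a, b))%:F); apply: inLocD => //;
      first exact: (pd_inL pd).
      by apply: inLocW (pd_lead pd ab) => p /andP[].
    by apply: inLoc_pol; apply: vars_in_y; rewrite U_inL.
  by split=> //; apply: inLocM => //; apply: Vloc.
- move=> G GD GM GC Gz Gpq GY.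
  have Gzs w : w \in zs -> G w%:F /\ G (w%:F)^-1.
    by move=> wz; apply: Gz; rewrite mem_rcons inE wz orbT.
  have G1 : G 1 by have := GC 1; rewrite mpolyC1 tofrac1.
  have [Gz1 Gz2] : G z%:F /\ G (z%:F)^-1 by apply: Gz; rewrite mem_rcons inE eqxx.
  have [Gm1 Gm2] : G m%:F /\ G (m%:F)^-1.
    case: hm => e0 ->; elim/big_rec: _ => [|j x _ [h1 h2]].
      by rewrite tofrac1 invr1.
    have [g1 g2] := Gzs _ (mem_nth 0 (ltn_ord j)).
    have GX x0 i : G x0 -> G (x0 ^+ i).
      by move=> gx; elim: i => [|i IH]; rewrite ?expr0 // exprS; apply: (GM).
    by rewrite tofracM tofracXn invfM -exprVn; split; apply: (GM) => //; apply: GX.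
  have GYkt : G (Y k t) by rewrite ez; apply: (GM).
  have GYktV : G (Y k t)^-1 by rewrite ez invf_div; apply: (GM).
  (* With Y_kt = z / m and its inverse available, the old family is recovered from the corrected
     one, and the previous generation property finishes. *)
  apply: (pd_gen pd) => //.
    by move=> x xpq; apply: Gpq; rewrite mem_cat xpq.
  apply: (lie_next_gen invU top lieY (G := G)) => //.
  - by have := GC (-1); rewrite mpolyCN mpolyC1 tofracN tofrac1.
  - by have := GC 0; rewrite mpolyC0 tofrac0.
  - move=> a ka at_.
    have /Gpq[/= g1 g2] : (Y k a, Y a t / Y k t) \in pq' (Y k t).
      by rewrite mem_cat; apply/orP; right; apply/mapP; exists a;
        rewrite // mem_filter ka at_ mem_enum.
    by split=> //; rewrite -[Y a t](mulfVK Y0); apply: (GM).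
Qed.

End ProcessStep.
End State.

(** * The filling procedure as a sequence of reduction steps *)

Section Diagram.
Variables (K : fieldType) (n : nat) (M : {set place n}).
Hypothesis idM : ideal_places (Mrel M).
Local Notation Pol := (Pol K n).
Local Notation Frac := (Frac K n).
Local Notation "x %:F" := (@FracField.tofrac _ x : Frac).
Local Notation br := (@fbr K n M).

Definition process_state (st : labels n * seq (place n)) :=
  exists U t zs pq Y, (forall a b, U a b = unfilled st.1 (a, b)) /\
    @process_data K n M U st.2 t zs pq Y.

(** Initially every place below the diagonal is unfilled or in M, so the relation is just b < a and
    the family consists of the variables themselves. *)
Lemma process_init : process_state (diag_init M).
Proof.
have arrowE a b : arrow (fun a b => inL M (a, b)) (Mrel M) a b = (b < a)%N.
  rewrite /arrow /inL /inA /Mrel /=; case: ((a, b) \in M) / idP => h.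
    by rewrite andbF /= (idM.1 _ _ h).
  by rewrite andbT orbF.
exists (fun a b => inL M (a, b)), 0%N, [::], [::], (fun a b => (yL K M (a, b))%:F).
split=> [a b|].
  by rewrite /unfilled /inL ffunE; case: (_ \in M).
split=> //=.
- split=> // [a b /andP[]|a b /andP[]|a b c|a b c|c j d _ _] //; rewrite !arrowE.
  + exact: (fun h1 h2 => ltn_trans h2 h1).
  + by move=> /andP[_ ->].
  + by case/andP.
- split=> [a b /negPf h|a b c d h1 h2]; first by rewrite /yL h tofrac0.
  rewrite /= {1 2}/yL h1 h2 fbr_yy // /lbr /= tofracB !tofracM.
  by rewrite !rmorph_nat.
- by move=> i j p0; rewrite ltn0 andbF.
- by move=> a b h; rewrite /yL h subrr; apply: inLoc0.
- by move=> G _ _ _ _ _ h [a b] Lab; have := h a b; rewrite /yL Lab.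
Qed.

Lemma exists_top (lab : labels n) p0 : unfilled lab p0 ->
  exists p, unfilled lab p && [forall q, unfilled lab q ==> (q == p) || gtA p q].
Proof.
(* Minimizing [mu] selects the greatest place: n - p.1 lies between 1 and n, so it never outweighs a
   difference of columns. *)
move=> up0; pose mu (p : place n) := (p.2 * n + (n - p.1))%N.
case: (arg_minnP mu up0) => p up hp; exists p; rewrite up; apply/forallP => q.
apply/implyP => uq; have := hp q uq; rewrite /mu /gtA.
case: p {up hp} => a b; case: q {uq} => c d /=.
rewrite xpair_eqE -!val_eqE /=; have := ltn_ord a; have := ltn_ord c => hc ha h.
by case: (ltngtP d b) => bd; nia.
Qed.

(** The first alternative is an idle step after the process has ended. In the second, the bounds t <
    a < k of the filling rule match [unfilled_next] because unfilled places lie below the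
    diagonal. *)
Lemma diag_stepP (lab lab' : labels n) Sq Sq' :
  diag_step (lab, Sq) = (lab', Sq') ->
  [/\ lab' = lab, Sq' = Sq & forall p, ~~ unfilled lab p] \/
  exists k t, [/\ top_unfilled (fun a b => unfilled lab (a, b)) k t,
    Sq' = rcons Sq (k, t) &
    forall a b, unfilled lab' (a, b)
      = unfilled_next (fun a b => unfilled lab (a, b)) k t a b].
Proof.
rewrite /diag_step; case: pickP => [[k t] /andP[ukt /forallP top]|none]; last first.
  case=> <- <-; left; split=> // p; apply/negP => up.
  by have [q hq] := exists_top up; have := none q; rewrite hq.
case=> <- <-; right; exists k, t; split=> //.
  split=> // a b uab; have := implyP (top (a, b)) uab; rewrite xpair_eqE /gtA /=.
  case/orP=> [/andP[/eqP-> /eqP->]|/orP[->|/andP[/eqP-> /ltnW]]];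
    by [right | left | right].
move=> a b; rewrite /unfilled_next /unfilled ffunE /inA /=.
rewrite /unfilled /inA /=.
case: (ltnP b a) => //= ba.
case: eqP => [_|nkt]; first by rewrite andbF.
case E: (lab (a, b)) => [x|] /=; first by case: ifP => // _; case: ifP.
have [ak|ak] := eqVneq a k; have [bt|bt] := eqVneq b t; subst => /=.
- by case: nkt.
- rewrite ba E /= !andbT.
  by case: (t < b)%N => //=; case: (lab (b, t)).
- rewrite ba E /= !andbT.
  by case: (a < k)%N => //=; case: (lab (k, a)).
- done.
Qed.

Lemma process_next st : process_state st -> process_state (diag_step st).
Proof.
case: st => lab Sq; case E: (diag_step (lab, Sq)) => [lab' Sq'].
move=> [U [t0 [zs [pq [Y [UE pd]]]]]] /=.
have [[-> -> _]|[k [t [[ukt top] -> nextE]]]] := diag_stepP E.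
  by exists U, t0, zs, pq, Y.
have topU : top_unfilled U k t.
  by split=> [|a b]; rewrite UE //; exact: top.
have [z [pq1 pd']] := process_step idM pd topU.
exists (unfilled_next U k t), t, (rcons zs z), pq1, (lie_next U Y k t); split;
  last exact: pd'.
by move=> a b; rewrite nextE /unfilled_next !UE.
Qed.

Definition nb_unfilled (lab : labels n) := #|[pred p | unfilled lab p]|.

(** An active step fills at least (k,t); an idle one occurs only at count 0, which is its own
    predecessor. *)
Lemma nb_unfilled_step st :
  (nb_unfilled (diag_step st).1 <= (nb_unfilled st.1).-1)%N.
Proof.
case: st => lab Sq; case E: (diag_step (lab, Sq)) => [lab' Sq'] /=.
have [[-> _ none]|[k [t [[ukt _] _ nextE]]]] := diag_stepP E.
  by rewrite /nb_unfilled eq_card0 // => p; rewrite inE; apply/negbTE.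
rewrite /nb_unfilled (cardD1 (k, t) [pred p | unfilled lab p]) inE ukt /=.
apply: subset_leq_card; apply/subsetP => [[a b]]; rewrite !inE nextE.
by case/and4P=> -> -> _ _.
Qed.

Lemma diagram_complete p : unfilled (diagram M).1 p = false.
Proof.
have h r : (nb_unfilled (iter r (@diag_step n) (diag_init M)).1 <= n * n - r)%N.
  elim: r => [|r IH] /=.
    by rewrite subn0 (leq_trans (max_card _)) // card_prod card_ord.
  by have := nb_unfilled_step (iter r (@diag_step n) (diag_init M)); lia.
have := h (n * n)%N; rewrite subnn leqn0 => /eqP /card0_eq /(_ p).
by rewrite inE.
Qed.

Lemma process_diagram : exists U t zs pq Y, (forall a b, U a b = false) /\
  @process_data K n M U (Sseq M) t zs pq Y.
Proof.
have [U [t [zs [pq [Y [UE pd]]]]]] : process_state (diagram M).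
  rewrite /diagram; elim: (n * n)%N => [|r IH]; first exact: process_init.
  exact: process_next.
by exists U, t, zs, pq, Y; split=> // a b; rewrite UE diagram_complete.
Qed.

End Diagram.

(** * Casimirs are invariant under the coadjoint action *)

Lemma rmorph_mmap (R : comNzRingType) (S T : comNzRingType) (N : nat)
    (psi : {rmorphism S -> T}) (f : R -> S) (h : 'I_N -> S) (p : {mpoly R[N]}) :
  psi (mmap f h p) = mmap (psi \o f) (psi \o h) p.
Proof.
rewrite /mmap rmorph_sum; apply: eq_bigr => m _; rewrite rmorphM; congr (_ * _).
by rewrite /mmap1 rmorph_prod; apply: eq_bigr => i _; rewrite rmorphXn.
Qed.

Section Invariance.
Variables (K : fieldType) (n : nat) (M : {set place n}).
Hypothesis hK : [pchar K] =i pred0.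
Hypothesis idM : ideal_places (Mrel M).
Local Notation Pol := (Pol K n).
Local Notation B := {poly Pol}.

Lemma char0_mulrn (p : Pol) m : p *+ m.+1 = 0 -> p = 0.
Proof.
move=> h; apply/mpolyP => x; have := congr1 (mcoeff x) h.
rewrite mcoeffMn mcoeff0 -mulr_natr => /eqP; rewrite mulf_eq0.
by rewrite (pcharf0P K).1 // orbF => /eqP.
Qed.

(** In characteristic zero a vanishing derivative leaves only the constant coefficient; this
    compares the two ends of a path. *)
Lemma deriv_eq0_horner (p : B) (a b : Pol) : p^`() = 0 -> p.[a] = p.[b].
Proof.
move=> h; suff -> : p = (p`_0)%:P by rewrite !hornerC.
apply/polyP => [[|i]]; rewrite coefC //=.
apply: (@char0_mulrn _ i); by rewrite -coef_deriv h coef0.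
Qed.

(* [G] plays the role of the path 1 + X(g - 1), [H] that of its inverse and [N]
   that of its derivative g - 1. *)
Section Path.
Variables (c : {rmorphism K -> B}) (N G H : 'M[B]_n).
Hypothesis c_const : forall a, (c a)^`() = 0.
Hypothesis N0 : forall i j : 'I_n, (i <= j)%N -> N i j = 0.
Hypothesis G0 : forall i j : 'I_n, (i < j)%N -> G i j = 0.
Hypothesis G1 : forall i, G i i = 1.
Hypotheses (GH : G *m H = 1%:M) (HG : H *m G = 1%:M).
Let E (p : place n) : 'M[B]_n := delta_mx p.1 p.2.

(** Forward substitution in G H = 1, by strong induction on the row. *)
Let H0 (i j : 'I_n) : (i < j)%N -> H i j = 0.
Proof.
move=> ij; have [m] := ubnP i; elim: m i ij => // m IH i ij im.
have := congr1 (fun A : 'M[B]_n => A i j) GH;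
  rewrite mxE (bigD1 i) //= G1 mul1r big1 ?addr0.
  by move=> ->; rewrite mxE -val_eqE /= (ltn_eqF ij).
move=> k ki; have [ik|] := ltnP i k; first by rewrite G0 // mul0r.
rewrite leq_eqVlt val_eqE (negPf ki) /= => ltki.
by rewrite (IH _ (ltn_trans ltki ij) (leq_trans ltki im)) mulr0.
Qed.

(** The action along the path, extended linearly from matrix units to all matrices so that
    commutators can be inserted. *)
Definition img (A : 'M[B]_n) : B := \sum_(q | inL M q) (G *m A *m H) q.1 q.2 * (y
  K q)%:P.

Let imgD A A' : img (A + A') = img A + img A'.
Proof.
rewrite /img -big_split; apply: eq_bigr => q _ /=.
by rewrite mulmxDr mulmxDl mxE mulrDl.
Qed.

Let imgZ a A : img (a *: A) = a * img A.
Proof.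
rewrite /img mulr_sumr; apply: eq_bigr => q _ /=.
by rewrite -scalemxAr -scalemxAl mxE mulrA.
Qed.

Let img0 : img 0 = 0.
Proof. by rewrite /img big1 // => q _; rewrite mulmx0 mul0mx mxE mul0r. Qed.

Let img_sum (I : Type) (r : seq I) (P : pred I) (A : I -> 'M[B]_n) :
  img (\sum_(i <- r | P i) A i) = \sum_(i <- r | P i) img (A i).
Proof. by elim/big_rec2: _ => [|i x1 x2 _ <-]; [exact: img0 | rewrite imgD]. Qed.

(** Conjugation by lower triangular matrices spreads E_p only downwards and to the left, hence
    inside M. *)
Let imgE_M p : p \in M -> img (E p) = 0.
Proof.
move=> Mp; rewrite /img big1 // => q /andP[_ /negP nq].
rewrite (_ : (_ *m _) q.1 q.2 = 0) ?mul0r // mxE big1 // => j _.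
rewrite mxE (bigD1 p.1) //= big1 ?addr0 => [|i ip]; last first.
  by rewrite mxE (negPf ip) mulr0.
rewrite mxE eqxx /=; have [->|_] := eqVneq j p.2; last by rewrite mulr0 mul0r.
rewrite mulr1; have [qp|qp] := ltnP q.1 p.1; first by rewrite G0 // mul0r.
have [pq|pq] := ltnP p.2 q.2; first by rewrite H0 // mulr0.
case: nq; rewrite [q]surjective_pairing.
by apply: (idM.2 p.1 p.2) => //; rewrite /Mrel -surjective_pairing.
Qed.

Definition imgL (k : 'I_(nvar n)) : B := if inL M (enum_val k) then img (E
  (enum_val k)) else 0.
Definition phi : Pol -> B := mmap c imgL.

Let phi_yL p : inA p -> phi (yL K M p) = img (E p).
Proof.
move=> Ap; rewrite /yL; case Lp: (inL M p).
  by rewrite /phi /y mmapX mmap1U /imgL /vidx enum_rankK Lp.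
rewrite /phi mmap0 imgE_M //; apply/negPn/negP => nM.
by rewrite /inL Ap nM in Lp.
Qed.

Let phiM f f' : phi (f * f') = phi f * phi f'.
Proof. exact: rmorphM. Qed.
Let phiB f f' : phi (f - f') = phi f - phi f'.
Proof. exact: rmorphB. Qed.
Let phi_nat m : phi m%:R = m%:R.
Proof. exact: rmorph_nat. Qed.
Let phi_sum (I : Type) (r : seq I) (P : pred I) (f : I -> Pol) :
  phi (\sum_(i <- r | P i) f i) = \sum_(i <- r | P i) phi (f i).
Proof. exact: rmorph_sum. Qed.

Let comm p q := E p *m E q - E q *m E p.

Let commE p q : comm p q =
  (p.2 == q.1)%:R *: E (p.1, q.2) - (q.2 == p.1)%:R *: E (q.1, p.2).
Proof. by rewrite /comm /E !mul_delta_mx_cond !scaler_nat. Qed.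

(** Turns matrix commutators into Poisson brackets. If r lies in M, both products land in M, where
    [img] vanishes. *)
Let img_comm r p : inA r -> inL M p -> img (comm r p) =
  if inL M r then phi (lbr K M r p) else 0.
Proof.
move=> Ar Lp; have /andP[Ap _] := Lp.
have imgB A A' : img (A - A') = img A - img A'.
  by rewrite imgD -scaleN1r imgZ mulN1r.
rewrite commE imgB !imgZ.
have A1 : r.2 == p.1 -> inA (r.1, p.2).
  by move=> /eqP e; move: Ar Ap; rewrite /inA /= e => h1 h2; exact: ltn_trans h2 h1.
have A2 : p.2 == r.1 -> inA (p.1, r.2).
  by move=> /eqP e; move: Ar Ap; rewrite /inA /= e => h1 h2; exact: ltn_trans h1 h2.
case: ifP => Lr.
  rewrite /lbr phiB !phiM !phi_nat; congr (_ - _).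
    by case: eqP A1 => [_ /(_ isT) h|_ _]; rewrite ?mul0r // phi_yL.
  by case: eqP A2 => [_ /(_ isT) h|_ _]; rewrite ?mul0r // phi_yL.
have Mr : Mrel M r.1 r.2.
  by rewrite /Mrel -surjective_pairing; apply/negPn/negP => h; rewrite /inL Ar h in Lr.
have z1 : r.2 == p.1 -> img (E (r.1, p.2)) = 0.
  move=> /eqP e; apply: imgE_M; apply: (idM.2 _ _ _ _ Mr) => //.
  by move: Ap; rewrite /inA e => /ltnW.
have z2 : p.2 == r.1 -> img (E (p.1, r.2)) = 0.
  move=> /eqP e; apply: imgE_M; apply: (idM.2 _ _ _ _ Mr) => //.
  by move: Ap; rewrite /inA e => /ltnW.
case: (r.2 == p.1) z1 => [/(_ isT) ->|_]; case: (p.2 == r.1) z2 => [/(_ isT) ->|_];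
  by rewrite ?mul0r ?mulr0 subrr.
Qed.

Local Notation dm := (map_mx (@deriv Pol)).

Let dmM (A A' : 'M[B]_n) : dm (A *m A') = dm A *m A' + A *m dm A'.
Proof.
apply/matrixP => i j; rewrite !mxE linear_sum -big_split; apply: eq_bigr => k _ /=.
by rewrite derivM !mxE.
Qed.

Let dmE p : dm (E p) = 0.
Proof. by apply/matrixP => i j; rewrite !mxE; case: (_ && _);
  rewrite ?derivC // -?polyC1 derivC. Qed.

Let dm1 : dm (1%:M : 'M[B]_n) = 0.
Proof. by apply/matrixP => i j; rewrite !mxE -polyC_natr derivC. Qed.

Hypothesis dmG : dm G = N.

(** The logarithmic derivative G^-1 G' of the path, strictly lower triangular by [W0]. *)
Let W := H *m N.

Let dmH : dm H = - (W *m H).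
Proof.
have := congr1 (fun A : 'M[B]_n => dm A) GH; rewrite dmM dm1 dmG => /eqP;
  rewrite addrC addr_eq0 => /eqP h.
by rewrite -[LHS]mul1mx -HG -mulmxA h mulmxN /W !mulmxA.
Qed.

Let W0 (i j : 'I_n) : (i <= j)%N -> W i j = 0.
Proof.
move=> ij; rewrite mxE big1 // => k _.
have [ik|ki] := ltnP i k; first by rewrite H0 // mul0r.
by rewrite N0 ?mulr0 // (leq_trans ki).
Qed.

Let WE : W = \sum_(r : place n | inA r) W r.1 r.2 *: E r.
Proof.
rewrite {1}[W]matrix_sum_delta pair_big /= big_mkcond [RHS]big_mkcond /=.
apply: eq_bigr => r _; rewrite /inA; case: ltnP => // h.
by rewrite W0 // scale0r.
Qed.

(** The identity (G E G^-1)' = G [W, E] G^-1. *)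
Let deriv_img p : (img (E p))^`() = img (W *m E p - E p *m W).
Proof.
rewrite /img linear_sum; apply: eq_bigr => q _ /=.
rewrite derivM derivC mulr0 addr0; congr (_ * _).
have -> : ((G *m E p *m H) q.1 q.2)^`() = (dm (G *m E p *m H)) q.1 q.2 by rewrite
  [RHS]mxE.
rewrite !dmM dmE mulmx0 addr0 dmG dmH mulmxN.
by rewrite mulmxBr mulmxBl /W !mulmxA GH mul1mx.
Qed.

Let deriv_imgL p : inL M p -> (img (E p))^`() =
  \sum_(r | inL M r) W r.1 r.2 * phi (lbr K M r p).
Proof.
move=> Lp; rewrite deriv_img {1 2}WE mulmx_suml mulmx_sumr -sumrB img_sum.
rewrite big_mkcond [RHS]big_mkcond; apply: eq_bigr => r _.
case Ar: (inA r); last by rewrite /inL Ar.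
rewrite -scalemxAl -scalemxAr -scalerBr imgZ img_comm //.
by case: ifP; rewrite ?mulr0.
Qed.

Variable f : Pol.
Hypothesis f_S : inSL M f.
Hypothesis f_cas : forall r, inL M r -> \sum_(p | inL M p) f^`M(vidx p) * lbr K M
  p r = 0.

(** By the chain rule the derivative is the sum of -W_r phi({f, y_r}) over r, and each bracket is
    zero for a Casimir. *)
Lemma deriv_phi : (phi f)^`() = 0.
Proof.
have DP : is_derivation (@deriv Pol) by split=> [u v|u v];
  rewrite ?derivD // derivM addrC.
rewrite /phi (der_mmap DP c_const) (reindex (@vidx n)) /=; last first.
  by exists (fun k : 'I_(nvar n) => enum_val k : place n) => k _;
    [exact: enum_rankK | exact: enum_valK].
transitivity (\sum_(p | inL M p) phi f^`M(vidx p) *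
   \sum_(r | inL M r) W r.1 r.2 * phi (lbr K M r p)).
  rewrite [RHS]big_mkcond; apply: eq_bigr => p _; rewrite /imgL enum_rankK.
  by case: ifP => Lp; [rewrite deriv_imgL | rewrite deriv0 mulr0].
under eq_bigr do rewrite mulr_sumr.
rewrite exchange_big big1 //= => r Lr.
under eq_bigr do rewrite mulrCA -phiM lbrC mulrN -mulN1r.
rewrite -mulr_sumr -phi_sum -mulr_sumr f_cas // mulr0.
by rewrite (_ : phi 0 = 0) ?mulr0 // /phi mmap0.
Qed.

Lemma horner_phi (a : Pol) : (forall x : K, (c x).[a] = x%:MP) ->
  (phi f).[a] = mmap (@mpolyC _ K) (fun k => (imgL k).[a]) f.
Proof.
move=> ca; rewrite -[LHS]/(horner_eval a (phi f)) /phi rmorph_mmap.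
by rewrite /mmap; apply: eq_bigr => m _; congr (_ * _); exact: ca.
Qed.

Lemma horner_img a p : (img (E p)).[a] =
  \sum_(q | inL M q) (map_mx (horner_eval a) G *m delta_mx p.1 p.2
                       *m map_mx (horner_eval a) H) q.1 q.2 * y K q.
Proof.
rewrite /img horner_sum; apply: eq_bigr => q _; rewrite hornerM hornerC; congr (_ * _).
have -> : delta_mx p.1 p.2 = map_mx (horner_eval a) (E p) by rewrite map_delta_mx.
by rewrite -!map_mxM [RHS]mxE.
Qed.

End Path.

Let c : {rmorphism K -> B} := (polyC \o @mpolyC _ K).

Lemma inverse_mx_uniq (R : comUnitRingType) m (A A' C : 'M[R]_m) :
  A *m C = 1%:M -> A *m A' = 1%:M -> A' = C.
Proof. by move=> h /mulmx1C h'; rewrite -[LHS]mulmx1 -h mulmxA h' mul1mx. Qed.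

Lemma lowunitri_unit g : lowunitri g -> g \in unitmx (R := K) (n := n).
Proof.
move=> g_low; rewrite unitmxE det_trig; last first.
  by apply/is_trig_mxP => i j ij; have [_ ->] := g_low i j.
by rewrite big1 ?unitr1 // => i _; have [] := g_low i i.
Qed.

(** The path is unitriangular, hence of determinant 1, so its inverse is again polynomial in X and
    can be evaluated at both ends. *)
Lemma unipotent_path (g : 'M[K]_n) : lowunitri g -> exists N G H : 'M[B]_n,
  [/\ (forall i j : 'I_n, (i <= j)%N -> N i j = 0),
      (forall i j : 'I_n, (i < j)%N -> G i j = 0),
      (forall i, G i i = 1) & G *m H = 1%:M] /\
  [/\ H *m G = 1%:M, map_mx (@deriv _) G = N,
      map_mx (horner_eval 1) G = map_mx (@mpolyC _ K) g
    & map_mx (horner_eval 0) G = 1%:M].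
Proof.
move=> g_low; pose N : 'M[B]_n := \matrix_(i, j) (((g - 1%:M) i j)%:MP)%:P.
pose G : 'M[B]_n := \matrix_(i, j) ((i == j)%:R + 'X * N i j).
have NE i j : N i j = (((g - 1%:M) i j)%:MP)%:P by rewrite mxE.
have GE i j : G i j = (i == j)%:R + 'X * N i j by rewrite mxE.
have N0 (i j : 'I_n) : (i <= j)%N -> N i j = 0.
  have [h1 h2] := g_low i j; move=> ij; rewrite NE !mxE.
  have [<-|nij] := eqVneq i j; first by rewrite h1 subrr mpolyC0.
  by rewrite h2 ?subrr ?mpolyC0 // ltn_neqAle nij.
have G0 (i j : 'I_n) : (i < j)%N -> G i j = 0.
  move=> ij; rewrite GE N0 ?(ltnW ij) // mulr0 addr0.
  by rewrite (_ : i == j = false) //; apply/eqP => e; rewrite e ltnn in ij.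
have G1 i : G i i = 1 by rewrite GE N0 // mulr0 addr0 eqxx.
have G_unit : G \in unitmx.
  rewrite unitmxE det_trig; last by apply/is_trig_mxP => i j /G0.
  by rewrite big1 ?unitr1 // => i _; rewrite G1.
exists N, G, (invmx G); split; split=> //; [exact: mulmxV | exact: mulVmx | | |].
- apply/matrixP => i j; rewrite mxE GE derivD derivM derivX mul1r.
  by rewrite -polyC_natr derivC add0r NE derivC mulr0 addr0.
- apply/matrixP => i j; rewrite mxE /horner_eval GE hornerD hornerM hornerX mul1r.
  rewrite NE hornerC -polyC_natr hornerC !mxE mpolyCB.
  by rewrite (rmorph_nat (@mpolyC _ K)) addrC subrK.
- apply/matrixP => i j; rewrite mxE /horner_eval GE hornerD hornerM hornerX mul0r addr0.
  by rewrite -polyC_natr hornerC mxE.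
Qed.

Lemma coad_casimir (g : 'M[K]_n) f : lowunitri g -> inSL M f ->
  (forall r, inL M r -> \sum_(p | inL M p) f^`M(vidx p) * lbr K M p r = 0) ->
  coad M g f = f.
Proof.
move=> g_low f_S f_cas.
have [N [G [H [[N0 G0 G1 GH] [HG dG G_1 G_0]]]]] := unipotent_path g_low.
have GHa a : map_mx (horner_eval a) G *m map_mx (horner_eval a) H = 1%:M.
  by rewrite -map_mxM GH map_mx1.
have H_0 : map_mx (horner_eval 0) H = 1%:M.
  by have := GHa 0; rewrite G_0 mul1mx.
have H_1 : map_mx (horner_eval 1) H = map_mx (@mpolyC _ K) (invmx g).
  apply: (inverse_mx_uniq (A := map_mx (@mpolyC _ K) g)); last by rewrite -G_1.
  by rewrite -map_mxM mulmxV ?lowunitri_unit // map_mx1.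
have c_const a : (c a)^`() = 0 by rewrite derivC.
have dphi := deriv_phi c_const N0 G0 G1 GH HG dG f_cas.
have c_ev a x : (c x).[a] = x%:MP by rewrite /= hornerC.
have := deriv_eq0_horner 1 0 dphi; rewrite !horner_phi // => e.
(* At X = 1 the path acts as g. *)
transitivity (mmap (@mpolyC _ K) (fun k => (imgL G H k).[1]) f).
  apply: eq_bigr => m _; congr (_ * _); apply: eq_bigr => k _; congr (_ ^+ _).
  rewrite /imgL /coad_img; case: ifP => _; last by rewrite horner0.
  rewrite horner_img G_1 H_1; apply: eq_bigr => q _.
  rewrite -mul_mpolyC; congr (_ * _).
  set p := enum_val k.
  have -> : delta_mx p.1 p.2 = map_mx (@mpolyC _ K) (delta_mx p.1 p.2) :> 'M[Pol]_n.
    by rewrite map_delta_mx.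
  by rewrite -!map_mxM [RHS]mxE.
(* At X = 0 the path is the identity, so every variable in [inL] is fixed; the others do not occur
   in f. *)
rewrite e [RHS](mpolyE f) /mmap; apply: eq_big_seq => m mf.
rewrite mul_mpolyC; congr (_ *: _); rewrite -[RHS]mmap1_id.
apply: eq_bigr => k _; rewrite /imgL.
case: ifP => Lp; last first.
  by have := f_S m mf _ (negbT Lp); rewrite /vidx enum_valK => ->; rewrite !expr0.
congr (_ ^+ _); set p := enum_val k in Lp *.
rewrite horner_img G_0 H_0 mul1mx mulmx1 (bigD1 p) //= mxE !eqxx mul1r.
rewrite big1 ?addr0 /y /vidx ?enum_valK // => q /andP[_ qp].
by rewrite mxE -xpair_eqE -!surjective_pairing (negPf qp) mul0r.
Qed.

End Invariance.

(** * The model K[z^{+-1}] (x) A_m *)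

Lemma mmap_closed (R S : comNzRingType) (N : nat) (G : S -> Prop)
    (c : R -> S) (v : 'I_N -> S) (f : {mpoly R[N]}) :
  (forall x w, G x -> G w -> G (x + w)) ->
  (forall x w, G x -> G w -> G (x * w)) -> G 0 -> G 1 ->
  (forall a, G (c a)) ->
  (forall m k, m \in msupp f -> m k != 0%N -> G (v k)) -> G (mmap c v f).
Proof.
move=> GD GM G0 G1 Gc Gv; rewrite /mmap big_seq; elim/big_ind: _ => // m mf.
apply: (GM) => //; rewrite /mmap1; elim/big_ind: _ => // k _.
case: (m k) (Gv m k mf) => [|d] /= h; first by rewrite expr0.
have gv := h isT; elim: d {h} => [|d IH]; first by rewrite expr1.
by rewrite exprS; apply: (GM).
Qed.

Lemma mpoly_deriv_eq0 (K : fieldType) N (f : {mpoly K[N]}) : [pchar K] =i pred0 ->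
  (forall k, f^`M(k) = 0) -> f = (f@_0)%:MP.
Proof.
move=> hK h; apply/mpolyP => m; rewrite mcoeffC eq_sym.
have [->|m0] := eqVneq m 0%MM; first by rewrite mulr1.
rewrite mulr0; have [k mk] : exists k, m k != 0%N.
  apply/existsP; rewrite -negb_forall; apply: contra m0 => /forallP e.
  by apply/eqP/mnmP => k; rewrite mnm0E; apply/eqP.
have := congr1 (mcoeff (m - U_(k))%MM) (h k).
rewrite mcoeff_deriv mcoeff0 submK ?lep1mP // => /eqP.
by rewrite -mulr_natr mulf_eq0 (pcharf0P K).1 // orbF => /eqP.
Qed.

Lemma mdeg_mderiv (K : fieldType) N (f : {mpoly K[N]}) k d :
  (forall m, m \in msupp f -> (mdeg m < d.+1)%N) ->
  forall m, m \in msupp f^`M(k) -> (mdeg m < d)%N.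
Proof.
move=> h m; rewrite mcoeff_msupp mcoeff_deriv => nz.
have /h : (m + U_(k))%MM \in msupp f.
  by rewrite mcoeff_msupp; apply: contra nz => /eqP ->; rewrite mul0rn.
by rewrite mdegD mdeg1 addn1.
Qed.

(** * Evaluation of the model at the central elements and canonical pairs *)

Section ModelEvaluation.
Variables (K : fieldType) (n : nat) (M : {set place n}).
Hypothesis hK : [pchar K] =i pred0.
Local Notation Pol := (Pol K n).
Local Notation Frac := (Frac K n).
Local Notation "x %:F" := (@FracField.tofrac _ x : Frac).
Local Notation br := (@fbr K n M).
Let brP := fbr_poisson K M.
Variables (U : rel 'I_n) (S : seq (place n)) (t : nat) (zs : seq Pol).
Variables (pq : seq (Frac * Frac)) (Y : 'I_n -> 'I_n -> Frac).
Hypothesis U0 : forall a b, U a b = false.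
Hypothesis pd : process_data M U S t zs pq Y.
Local Notation s := (size S).
Local Notation m := (size pq).
Local Notation Mod := (Mod K s m).
Let c : {rmorphism K -> Frac} := (@FracField.tofrac Pol \o @mpolyC _ K).
Let zF (i : 'I_s) : Frac := (zs`_i)%:F.
Let pp (j : 'I_m) : Frac := (nth (0, 0) pq j).1.
Let qq (j : 'I_m) : Frac := (nth (0, 0) pq j).2.

Definition model_val (k : 'I_(s + (m + m))) : Frac :=
  match split k with
  | inl i => zF i
  | inr k' => match split k' with inl j => pp j | inr j => qq j end
  end.

Definition model_ev (F : Mod) : Frac := mmap c model_val F.

Let valZ i : model_val (Zi m i) = zF i.
Proof. by rewrite /model_val /Zi; case: splitP => [j /= /val_inj -> //|j /=];
  have := ltn_ord i; lia. Qed.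
Let splitl a b (i : 'I_a) : split (lshift b i) = inl i.
Proof. exact: (unsplitK (inl _ i)). Qed.
Let splitr a b (i : 'I_b) : split (rshift a i) = inr i.
Proof. exact: (unsplitK (inr _ i)). Qed.
Let valP j : model_val (Pj s j) = pp j.
Proof. by rewrite /model_val /Pj splitr splitl. Qed.
Let valQ j : model_val (Qj s j) = qq j.
Proof. by rewrite /model_val /Qj !splitr. Qed.

Let mem_z (i : 'I_s) : zs`_i \in zs.
Proof. by apply: mem_nth; rewrite (pd_size pd). Qed.

Let brZ i w : br (zF i) w = 0. Proof. exact: (pd_casimir pd w (mem_z i)). Qed.

Let can (i j : 'I_m) : [/\ br (pp i) (pp j) = 0, br (qq i) (qq j) = 0,
  br (pp i) (qq j) = (i == j)%:R & br (pp j) (qq i) = (i == j)%:R].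
Proof. exact: (pd_canonical pd (ltn_ord i) (ltn_ord j)). Qed.

Let sum_split (f : 'I_(s + (m + m)) -> Frac) : \sum_k f k =
  \sum_i f (Zi m i) + (\sum_j f (Pj s j) + \sum_j f (Qj s j)).
Proof. by rewrite big_split_ord /= big_split_ord. Qed.

Let ev_der (D : Frac -> Frac) F : is_derivation D -> (forall a, D (c a) = 0) ->
  D (model_ev F) = \sum_k model_ev F^`M(k) * D (model_val k).
Proof. by move=> DP Dc; apply: der_mmap. Qed.

Let br_ev F w : br (model_ev F) w = \sum_k model_ev F^`M(k) * br (model_val k) w.
Proof.
apply: (ev_der (D := fun x => br x w)); first exact: fbr_derivation.
by move=> a; apply: fbr_const.
Qed.

Let br_ev_p F j : br (model_ev F) (pp j) = - model_ev F^`M(Qj s j).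
Proof.
rewrite br_ev sum_split big1 ?add0r => [|i _]; last by rewrite valZ brZ mulr0.
rewrite big1 ?add0r => [|i _]; last by rewrite valP; have [-> _ _ _] := can i j;
  rewrite mulr0.
rewrite (bigD1 j) //= big1 ?addr0 => [|i ij].
  by rewrite valQ (brC brP); have [_ _ -> _] := can j j; rewrite eqxx mulrN mulr1.
by rewrite valQ (brC brP); have [_ _ _ ->] := can i j; rewrite (negPf ij) oppr0 mulr0.
Qed.

Let br_ev_q F j : br (model_ev F) (qq j) = model_ev F^`M(Pj s j).
Proof.
rewrite br_ev sum_split big1 ?add0r => [|i _]; last by rewrite valZ brZ mulr0.
rewrite [X in _ + X]big1 ?addr0 => [|i _]; last by rewrite valQ;
  have [_ -> _ _] := can i j; rewrite mulr0.
rewrite (bigD1 j) //= big1 ?addr0 => [|i ij].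
  by rewrite valP; have [_ _ -> _] := can j j; rewrite eqxx mulr1.
by rewrite valP; have [_ _ -> _] := can i j; rewrite (negPf ij) mulr0.
Qed.

Let evB F G : model_ev (F - G) = model_ev F - model_ev G. Proof. exact: rmorphB. Qed.
Let evM F G : model_ev (F * G) = model_ev F * model_ev G. Proof. exact: rmorphM. Qed.
Let ev0 : model_ev 0 = 0. Proof. exact: mmap0. Qed.

Lemma model_ev_br F G : model_ev (modbr F G) = br (model_ev F) (model_ev G).
Proof.
rewrite br_ev sum_split big1 ?add0r => [|i _]; last by rewrite valZ brZ mulr0.
rewrite /modbr -[LHS]/(mmap c model_val _) rmorph_sum -big_split;
  apply: eq_bigr => j _ /=.
rewrite -/(model_ev _) evB !evM valP valQ; congr (_ + _).
  by rewrite (brC brP) br_ev_p opprK.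
by rewrite (brC brP) br_ev_q mulrN.
Qed.

Let p0 (i : 'I_s) : place n := tnth (in_tuple S) i.

Lemma model_ev_inj F : model_ev F = 0 -> F = 0.
Proof.
have [d] : exists d, forall x, x \in msupp F -> (mdeg x < d)%N.
  by exists (msize F) => x; apply: msize_mdeg_lt.
elim: d F => [|d IH] F hd F0.
  apply: msuppnil0; case E: (msupp F) => [//|x r].
  by have := hd x; rewrite E mem_head => /(_ isT).
have dF k : model_ev F^`M(k) = 0 -> F^`M(k) = 0.
  by apply: IH; apply: mdeg_mderiv hd.
have dP j : F^`M(Pj s j) = 0 by apply: dF; rewrite -br_ev_q F0 (br0l brP).
have dQ j : F^`M(Qj s j) = 0.
  by apply: dF; apply/eqP; rewrite -oppr_eq0 -br_ev_p F0 (br0l brP).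
(* Descending induction on i. Differentiate [model_ev F = 0] in y_{xi_i}: each z_j with j < i is
   free of this variable, and the terms with j > i vanish by induction. Only the term of z_i
   remains, and its derivative factor is nonzero. *)
have dZ (i : 'I_s) : F^`M(Zi m i) = 0.
  have [r] := ubnP (s - i); elim: r i => // r IHr i ir.
  pose D := @fderiv K n (vidx (tnth (in_tuple S) i)).
  have DP : is_derivation D by apply: fderiv_derivation.
  have Dc a : D (c a) = 0 by rewrite /D fderiv_tofrac mderivC tofrac0.
  have := ev_der F DP Dc; rewrite F0 (der0 DP) sum_split.
  rewrite [X in _ + (X + _)]big1 => [|j _]; last by rewrite dP ev0 mul0r.
  rewrite [X in _ + (_ + X)]big1 => [|j _]; last by rewrite dQ ev0 mul0r.
  have diff (j : 'I_s) : (j <= i)%N -> (D (zF j) == 0) = (j != i).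
    move=> ji; rewrite /D fderiv_tofrac tofrac_eq0 (tnth_nth (tnth (in_tuple S) i)).
    by rewrite (pd_diff pd) // ji (pd_size pd) ltn_ord.
  rewrite !addr0 (bigD1 i) //= big1 ?addr0 => [|j ji].
    move/esym/eqP; rewrite valZ mulf_eq0 diff // eqxx orbF => /eqP.
    exact: dF.
  have [ij|ij] := ltnP i j.
    by rewrite IHr ?ev0 ?mul0r //; have := ltn_ord j; lia.
  by rewrite valZ (eqP (_ : D (zF j) == 0)) ?mulr0 // diff.
have dall k : F^`M(k) = 0.
  rewrite -(splitK k); case: (split k) => [i|k'] /=; first exact: dZ.
  by rewrite -(splitK k'); case: (split k') => j /=; [exact: dP | exact: dQ].
(* All partial derivatives vanish, so F is constant in characteristic zero, and constants embed. *)
have [a FE] : exists a, F = a%:MP by exists F@_0; exact: mpoly_deriv_eq0.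
move: F0; rewrite FE /model_ev mmapC => /eqP.
by rewrite /= tofrac_eq0 mpolyC_eq0 => /eqP ->; rewrite mpolyC0.
Qed.

Let zpow (a : 'I_s -> nat) : Frac := \prod_i zF i ^+ a i.

Let zF0 i : zF i != 0.
Proof. by rewrite tofrac_eq0; apply: (pd_neq0 pd). Qed.

Let zpow_neq0 a : zpow a != 0.
Proof. by apply/prodf_neq0 => i _; rewrite expf_neq0. Qed.

Let zpowD a b : zpow (fun i => a i + b i)%N = zpow a * zpow b.
Proof. by rewrite /zpow -big_split; apply: eq_bigr => i _; rewrite exprD. Qed.

Let zmon_zpow x : zmon zs x -> exists a, x%:F = zpow a.
Proof.
case=> e ->; exists (fun i => e i); rewrite rmorph_prod (pd_size pd).
by apply: eq_bigr => i _; rewrite /= tofracXn.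
Qed.

(** The image of the localized model. It is closed under sums and products, so it can be fed to
    [pd_gen]. *)
Let inC (x : Frac) := exists F a, x = model_ev F / zpow a.

Let zpow0 : zpow (fun=> 0%N) = 1.
Proof. by rewrite /zpow big1 // => i _; rewrite expr0. Qed.

Let ev_zpow a : exists F, model_ev F = zpow a.
Proof.
exists (\prod_i 'X_(Zi m i) ^+ a i); rewrite /model_ev rmorph_prod.
by apply: eq_bigr => i _; rewrite rmorphXn /= mmapX mmap1U valZ.
Qed.

Let inC_ev F : inC (model_ev F).
Proof. by exists F, (fun=> 0%N); rewrite zpow0 divr1. Qed.

Let inCD x w : inC x -> inC w -> inC (x + w).
Proof.
move=> [F [a ->]] [G [b ->]].
have [A eA] := ev_zpow a; have [B eB] := ev_zpow b.
exists (F * B + G * A), (fun i => a i + b i)%N.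
rewrite zpowD addf_div // -eA -eB; congr (_ / _).
by rewrite -!evM -[LHS]rmorphD.
Qed.

Let inCM x w : inC x -> inC w -> inC (x * w).
Proof.
move=> [F [a ->]] [G [b ->]]; exists (F * G), (fun i => a i + b i)%N.
by rewrite zpowD evM mulf_div.
Qed.

Let inC_zV a : inC (zpow a)^-1.
Proof. by exists 1, a; rewrite (_ : model_ev 1 = 1) ?mul1r //; exact: rmorph1. Qed.

Let inC_c a : inC (c a).
Proof. by rewrite -[c a](mmapC model_val c); apply: inC_ev. Qed.

Let inC_val k : inC (model_val k).
Proof.
have := inC_ev 'X_k; rewrite (_ : model_ev 'X_k = model_val k) //.
by rewrite /model_ev mmapX mmap1U.
Qed.

Let inC0 : inC 0. Proof. by rewrite -ev0; apply: inC_ev. Qed.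
Let inC1 : inC 1. Proof. by rewrite -(rmorph1 c); apply: inC_c. Qed.

(** At the end no place is unfilled and Y vanishes, so the z, their inverses and the canonical pairs
    generate every variable. *)
Let inC_y p : inL M p -> inC (y K p)%:F.
Proof.
apply: (pd_gen pd (G := inC)) => //.
- move=> z zz; have iz : (index z zs < s)%N by rewrite -(pd_size pd) index_mem.
  have ez : z%:F = zF (Ordinal iz) by rewrite /zF /= nth_index.
  rewrite ez -[zF _]valZ; split; first exact: inC_val.
  have -> : model_val (Zi m (Ordinal iz)) = zpow (fun i => (i == Ordinal iz) : nat).
    rewrite valZ /zpow (bigD1 (Ordinal iz)) //= eqxx expr1 big1 ?mulr1 // => i
      /negPf ->.
    by rewrite expr0.
  exact: inC_zV.
- move=> x xpq; have ix : (index x pq < m)%N by rewrite index_mem.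
  have ex : nth (0, 0) pq (Ordinal ix) = x by rewrite nth_index.
  split; first by rewrite -ex -[_.1]/(pp _) -valP; apply: inC_val.
  by rewrite -ex -[_.2]/(qq _) -valQ; apply: inC_val.
- by move=> a b; rewrite (pd_lie pd).1 // U0.
Qed.

Lemma tofrac_mmap (f : Pol) : f%:F = mmap c (fun k => ('X_k : Pol)%:F) f.
Proof.
rewrite {1}(mpolyE f) rmorph_sum; apply: eq_bigr => x _.
rewrite -[_ *: _]mul_mpolyC rmorphM; congr (_ * _); rewrite -[in LHS]mmap1_id.
by rewrite /mmap1 rmorph_prod; apply: eq_bigr => i _; rewrite /= tofracXn.
Qed.

Let inC_S (f : Pol) : inSL M f -> inC f%:F.
Proof.
move=> hf; rewrite tofrac_mmap; apply: mmap_closed => // x k xf xk.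
have -> : 'X_k = y K (enum_val k) :> Pol by rewrite /y /vidx enum_valK.
apply: inC_y; apply: contraNT xk => nk.
by have := hf _ xf _ nk; rewrite /vidx enum_valK => ->.
Qed.

Let ev_loc F : inLoc zs (inL M) (model_ev F).
Proof.
have zL := pd_inL pd; have z0 := pd_neq0 pd.
apply: mmap_closed => [x w|x w||||_ k _ _].
- exact: inLocD.
- exact: inLocM.
- exact: inLoc0.
- by rewrite -(rmorph1 c); apply: inLocC.
- by move=> a; apply: inLocC.
rewrite /model_val; case: (split k) => [i|k'].
  by apply: inLoc_pol; apply: zL.
have h (j : 'I_m) := pd_loc pd (mem_nth (0, 0) (ltn_ord j)).
by case: (split k') => j; have [] := h j.
Qed.

(** One inclusion is generation; the other holds because each generator of the model evaluates into
    the localization. *)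
Lemma model_image x :
  (exists (f : Pol) a, inSL M f /\ x = f%:F / zpow a) <-> inC x.
Proof.
split=> [[f [a [hf ->]]]|[F [a ->]]].
  by apply: inCM; [exact: inC_S | exact: inC_zV].
have [f [w [hw hf ->]]] := ev_loc F; have [b ->] := zmon_zpow hw.
by exists f, (fun i => b i + a i)%N; split=> //; rewrite zpowD invfM mulrA.
Qed.
End ModelEvaluation.

(** The relation {z, y_r} = 0 in the fraction field has only polynomial terms, so it descends to the
    polynomial identity that [coad_casimir] asks for. *)
Lemma casimir_Linvariant (K : fieldType) (n : nat) (M : {set place n})
    (z : Pol K n) : [pchar K] =i pred0 -> ideal_places (Mrel M) -> inSL M z ->
  (forall w, fbr M (@FracField.tofrac _ z : Frac K n) w = 0) -> Linvariant M z.
Proof.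
move=> hK idM zL cas; split=> // g gl; apply: coad_casimir => // r Lr.
apply/eqP; rewrite -tofrac_eq0 -[X in _ == X](cas (y K r)%:F) fbr_gen rmorph_sum.
apply/eqP/eq_bigr => p Lp.
by rewrite fderiv_tofrac fbr_yy // -tofracM.
Qed.

Theorem theorem1 (K : fieldType) (hK : [pchar K] =i pred0)
  (n : nat) (hn : (2 <= n)%N) (M : {set place n}) (hM : is_ideal M) :
  let S := Sseq M in
  let s := size S in
  let xi (i : 'I_s) : place n := tnth (in_tuple S) i in
  exists z : 'I_s -> Pol K n,
    (* z_1, ..., z_s lie in K[L^*]^L *)
    (forall i, Linvariant M (z i)) /\
    (* (1) z_i = y_{xi_i} Q_i + P_{>i} *)
    (forall i : 'I_s,
       exists (e : 'I_s -> nat) (P : Pol K n),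
         vars_in (fun eta => inL M eta && gtA eta (xi i)) P /\
         z i = y K (xi i) * (\prod_(j < s | (j < i)%N) z j ^+ e j) + P) /\
    (* (2) K[L^*]_Z is Poisson-isomorphic to K[z^{+-1}] (x) A_m *)
    (exists (m : nat) (pp qq : 'I_m -> Frac K n),
       let zF (i : 'I_s) : Frac K n := (z i)%:F in
       let val (k : 'I_(s + (m + m))) : Frac K n :=
         match split k with
         | inl i => zF i
         | inr k' => match split k' with inl j => pp j | inr j => qq j end
         end in
       let ev (F : Mod K s m) : Frac K n :=
         mmap (fun c : K => ((c%:MP : Pol K n)%:F)) val F in
       let zpow (a : 'I_s -> nat) : Frac K n := \prod_(i < s) zF i ^+ a i in
       (* ev : Z_i |-> z_i, P_j |-> p_j, Q_j |-> q_j is injective on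
          K[Z, P, Q] (hence on its localization K[Z^{+-1}] (x) A_m) *)
       (forall F : Mod K s m, ev F = 0 -> F = 0) /\
       (* its (localized) image is exactly K[L^*]_Z *)
       (forall x : Frac K n,
          (exists (f : Pol K n) (a : 'I_s -> nat), inSL M f /\ x = f%:F / zpow a)
          <-> (exists (F : Mod K s m) (a : 'I_s -> nat), x = ev F / zpow a)) /\
       (* it is a morphism of Poisson algebras *)
       (forall F G : Mod K s m, ev (modbr F G) = fbr M (ev F) (ev G))).
Proof.
move=> S s xi; have idM := ideal_placesP hM.
have [U [t [zs [pq [Y [U0 pd]]]]]] := process_diagram K idM.
have szS : size zs = s := pd_size pd.
have zs_in (i : 'I_s) : zs`_i \in zs by apply: mem_nth; rewrite szS.
exists (fun i => zs`_i); split; [|split].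
- move=> i; apply: casimir_Linvariant => //; first exact: (pd_inL pd).
  by move=> w; apply: (pd_casimir pd).
- move=> i; have iz : (i < size zs)%N by rewrite szS.
  have [e [P [hP ez]]] := pd_form pd (xi i) iz.
  exists (fun j => e j), P; rewrite /xi (tnth_nth (xi i)); split=> //.
  by rewrite [LHS]ez (big_ord_widen s (fun j => zs`_j ^+ e j)) // ltnW.
exists (size pq), (fun j => (nth (0, 0) pq j).1), (fun j => (nth (0, 0) pq j).2).
move=> zF val ev zpow; split; [|split].
- exact: (model_ev_inj hK pd).
- exact: (model_image U0 pd).
- exact: (model_ev_br pd).
Qed.
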